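(* The logic $\mathbf{ID}_3$ is sound and complete relative to the rough sets semantics; that is, for every set $\Gamma$ of formulas and every formula $\alpha$ of the first-order language $L$, $$\Gamma \vdash \alpha \quad\text{if and only if}\quad \Gamma \vDash \alpha,$$ where $\vdash$ is derivability in $\mathbf{ID}_3$ and $\vDash$ is rough-set semantic consequence.
   Context: **Language.** $L$ has a denumerable set $Var_L$ of individual variables, a non-empty set of relation (predicate) letters, each of some arity $n\ge 1$ (no propositional letters, function symbols, constants or equality), connectives $\land,\lor,\neg,D,\bot$ of arities $2,2,1,1,0$, and quantifiers $\forall,\exists$. Formulas are defined as usual. **The logic $\mathbf{ID}_3$.** It is the natural deduction system with the following rules, for all formulas $\alpha,\beta,\gamma$: - the usual Gentzen rules for $\land$ (from $\alpha$ and $\beta$ infer $\alpha\land\beta$; from $\alpha\land\beta$ infer $\alpha$; from $\alpha\land\beta$ infer $\beta$) and for $\lor$ (from $\alpha$ infer $\alpha\lor\beta$; from $\beta$ infer $\alpha\lor\beta$; from $\alpha\lor\beta$, a derivation of $\gamma$ from assumption $\alpha$ and a derivation of $\gamma$ from assumption $\beta$, infer $\gamma$, discharging these assumptions); - intuitionistic negation: ($\neg$I) from a derivation of $\bot$ from assumption $\alpha$ infer $\neg\alpha$, discharging $\alpha$; ($\neg$E) from $\alpha$ and $\neg\alpha$ infer $\bot$; (EASQ) from $\bot$ infer $\alpha$; - ($D$I) infer $\alpha\lor D\alpha$ from no premises; ($D$E) from $D\alpha$ together with a derivation of $\alpha\lor\beta$ having no undischarged assumptions, infer $\beta$; - (S)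 infer $\neg\alpha\lor\neg\neg\alpha$ from no premises; (cS) from $D\alpha$ and $DD\alpha$ infer $\bot$; (Reg) from $\alpha$ and $D\alpha$ infer $\beta\lor\neg\beta$; - the usual Gentzen natural deduction introduction and elimination rules for $\forall$ and $\exists$, with the usual eigenvariable conditions. $\Gamma\vdash\alpha$ means that there is a derivation of $\alpha$ whose undischarged assumptions all lie in $\Gamma$. **Rough sets.** An approximation space is a pair $(U,\theta)$ with $U$ a non-empty set and $\theta$ an equivalence relation on $U$. Its $n$th power is $(U^n,\theta^n)$, where $((u_1,\dots,u_n),(v_1,\dots,v_n))\in\theta^n$ iff $(u_i,v_i)\in\theta$ for all $1\le i\le n$. For an approximation space $(U,\theta)$ and $X\subseteq U$, the lower approximation is $\underline{X}=\{u\in U:\text{ for all }x\in U,\text{ if }(u,x)\in\theta\text{ then }x\in X\}$ and the upper approximation is $\overline{X}=\{u\in U:\text{ there is }x\in X\text{ with }(u,x)\in\theta\}$. For $R\subseteq U^n$, $\underline{R}$ and $\overline{R}$ are computed in $(U^n,\theta^n)$. **Rough interpretations.** A rough interpretation of $L$ is $\mathcal{I}=(U,\theta,\sigma,f)$ where $(U,\theta)$ is an approximation space, $\sigma$ assigns to every $n$-ary predicate letter $R$ a relation $R^\sigma\subseteq U^n$, and $f:Var_L\to U$. For $a\in U$, $\mathcal{I}^{a/x}$ is like $\mathcal{I}$ but with $f$ replaced by $f^{a/x}$, where $f^{a/x}(x)=a$ and $f^{a/x}(y)=f(y)$ for $y\neq x$. **The algebra $\mathbf{3}$** has universe $\{0<\frac12<1\}$,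 with $\wedge=\min$, $\vee=\max$, $\neg 0=1$, $\neg\frac12=\neg 1=0$, $D0=D\frac12=1$, $D1=0$. **Valuation.** $v_{\mathcal I}$ maps formulas to $\{0,\frac12,1\}$: $v_{\mathcal I}(R(x_1,\dots,x_n))$ is $1$ if $(f(x_1),\dots,f(x_n))\in\underline{R^\sigma}$, is $\frac12$ if $(f(x_1),\dots,f(x_n))\in\overline{R^\sigma}\setminus\underline{R^\sigma}$, and is $0$ if $(f(x_1),\dots,f(x_n))\notin\overline{R^\sigma}$; $v_{\mathcal I}(\bot)=0$; $v_{\mathcal I}$ commutes with $\neg,D,\land,\lor$ as interpreted in $\mathbf 3$; $v_{\mathcal I}(\forall x\alpha)=\min\{v_{\mathcal I^{a/x}}(\alpha):a\in U\}$ and $v_{\mathcal I}(\exists x\alpha)=\max\{v_{\mathcal I^{a/x}}(\alpha):a\in U\}$. **Consequence.** $\Gamma\vDash\alpha$ means that for every rough interpretation $\mathcal I$ of $L$, $\min\{v_{\mathcal I}(\gamma):\gamma\in\Gamma\}\le v_{\mathcal I}(\alpha)$ (the minimum of the empty set being $1$). *)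

(* Defs.v *)
From mathcomp Require Import all_boot all_order.
From mathcomp Require Import boolp classical_sets.
From Stdlib Require Import RelationClasses.

Set Implicit Arguments.
Unset Strict Implicit.
Unset Printing Implicit Defensive.

Local Open Scope classical_set_scope.

Record language := Language {
  rel_letter :> Type;
  arity : rel_letter -> nat;
  arity_gt0 : forall R, 0 < arity R;
  rel_letter_inhabited : inhabited rel_letter }.

(* The denumerable set of individual variables is [nat]. *)
Inductive form (L : language) : Type :=
  | Atom (R : L) of (arity R).-tuple nat
  | Bot
  | And of form L & form L
  | Or of form L & form L
  | Neg of form L
  | Dneg of form L
  | All of nat & form L
  | Ex of nat & form L.

Arguments Atom {L} R _.
Arguments Bot {L}.

Fixpoint fv L (phi : form L) : seq nat :=
  match phi with
  | Atom _ xs => xs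
  | Bot => [::]
  | And a b | Or a b => fv a ++ fv b
  | Neg a | Dneg a => fv a
  | All x a | Ex x a => [seq y <- fv a | y != x]
  end.

(* [subst x y phi] puts [y] for the free occurrences of [x], without renaming
   bound variables; it is only used under [free_for y x phi]. *)
Fixpoint subst L (x y : nat) (phi : form L) : form L :=
  match phi with
  | Atom R xs => Atom R (map_tuple (fun z => if z == x then y else z) xs)
  | Bot => Bot
  | And a b => And (subst x y a) (subst x y b)
  | Or a b => Or (subst x y a) (subst x y b)
  | Neg a => Neg (subst x y a)
  | Dneg a => Dneg (subst x y a)
  | All z a => All z (if z == x then a else subst x y a)
  | Ex z a => Ex z (if z == x then a else subst x y a)
  end.

(* No free occurrence of [x] in [phi] is in the scope of a quantifier
   binding [y]. *)
Fixpoint free_for L (y x : nat) (phi : form L) : bool :=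
  match phi with
  | Atom _ _ | Bot => true
  | And a b | Or a b => free_for y x a && free_for y x b
  | Neg a | Dneg a => free_for y x a
  | All z a | Ex z a =>
      [|| z == x, x \notin fv a | (z != y) && free_for y x a]
  end.

(* [deriv G a]: there is a natural deduction derivation of [a] whose set of
   undischarged assumptions is exactly [G]. In a rule discharging [b], the
   premise may or may not use [b] (vacuous discharge is allowed), and the
   eigenvariable conditions concern the assumptions actually used, so that they
   remain meaningful when derivability from an infinite set is considered. *)
Inductive deriv (L : language) : set (form L) -> form L -> Prop :=
  | d_assume a : deriv [set a] a
  | d_andI G1 G2 a b : deriv G1 a -> deriv G2 b -> deriv (G1 `|` G2) (And a b)
  | d_andE1 G a b : deriv G (And a b) -> deriv G a
  | d_andE2 G a b : deriv G (And a b) -> deriv G b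
  | d_orI1 G a b : deriv G a -> deriv G (Or a b)
  | d_orI2 G a b : deriv G b -> deriv G (Or a b)
  | d_orE G G1 G2 a b c : deriv G (Or a b) -> deriv G1 c -> deriv G2 c ->
      deriv (G `|` (G1 `\ a) `|` (G2 `\ b)) c
  | d_negI G a : deriv G Bot -> deriv (G `\ a) (Neg a)
  | d_negE G1 G2 a : deriv G1 a -> deriv G2 (Neg a) -> deriv (G1 `|` G2) Bot
  | d_easq G a : deriv G Bot -> deriv G a
  | d_DI a : deriv set0 (Or a (Dneg a))
  | d_DE G a b : deriv G (Dneg a) -> deriv set0 (Or a b) -> deriv G b
  | d_S a : deriv set0 (Or (Neg a) (Neg (Neg a)))
  | d_cS G1 G2 a : deriv G1 (Dneg a) -> deriv G2 (Dneg (Dneg a)) ->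
      deriv (G1 `|` G2) Bot
  | d_Reg G1 G2 a b : deriv G1 a -> deriv G2 (Dneg a) ->
      deriv (G1 `|` G2) (Or b (Neg b))
  | d_allI G x y a : free_for y x a -> y \notin fv (All x a) ->
      (forall g, G g -> y \notin fv g) ->
      deriv G (subst x y a) -> deriv G (All x a)
  | d_allE G x y a : free_for y x a ->
      deriv G (All x a) -> deriv G (subst x y a)
  | d_exI G x y a : free_for y x a ->
      deriv G (subst x y a) -> deriv G (Ex x a)
  | d_exE G1 G2 x y a c : free_for y x a -> y \notin fv (Ex x a) ->
      y \notin fv c ->
      (forall g, (G2 `\ subst x y a) g -> y \notin fv g) ->
      deriv G1 (Ex x a) -> deriv G2 c ->
      deriv (G1 `|` (G2 `\ subst x y a)) c.

Definition derivable L (G : set (form L)) (a : form L) : Prop :=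
  exists2 G0 : set (form L), deriv G0 a & G0 `<=` G.

Record approx_space := ApproxSpace {
  space :> Type;
  indisc : space -> space -> Prop;
  space_inhabited : inhabited space;
  indisc_equiv : Equivalence indisc }.

Arguments indisc {a} _ _.

Definition pow_indisc (A : approx_space) n (u v : n.-tuple A) : Prop :=
  forall i, indisc (tnth u i) (tnth v i).

Fact pow_inhabited (A : approx_space) n : inhabited (n.-tuple A).
Proof. by case: (space_inhabited A) => a; split; exact: [tuple of nseq n a]. Qed.

Fact pow_indisc_equiv (A : approx_space) n : Equivalence (@pow_indisc A n).
Proof.
case: (indisc_equiv A) => rfl sym trans; split.
- by move=> u i; apply: rfl.
- by move=> u v uv i; apply: sym.
- by move=> u v w uv vw i; apply: trans (uv i) (vw i).
Qed.

Definition pow_space (A : approx_space) n : approx_space :=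
  ApproxSpace (pow_inhabited A n) (pow_indisc_equiv A n).

Definition lower_approx (A : approx_space) (X : set A) : set A :=
  [set u | forall x, indisc u x -> X x].

Definition upper_approx (A : approx_space) (X : set A) : set A :=
  [set u | exists2 x, X x & indisc u x].

Record rough_interp (L : language) := RoughInterp {
  universe : approx_space;
  rel_interp : forall R : L, set (pow_space universe (arity R));
  assign : nat -> universe }.

Definition upd L (I : rough_interp L) (x : nat) (a : universe I) :
    rough_interp L :=
  RoughInterp (@rel_interp L I) (fun y => if y == x then a else assign I y).

(* The chain 0 < 1/2 < 1 is the three-element ordinal with its library order. *)
Notation three := 'I_3.
Definition v0 : three := @Ordinal 3 0 isT.
Definition vhalf : three := @Ordinal 3 1 isT.
Definition v1 : three := @Ordinal 3 2 isT.

Definition neg3 (a : three) : three := if a == v0 then v1 else v0.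
Definition D3 (a : three) : three := if a == v1 then v0 else v1.

Definition min3 (X : set three) : three :=
  \big[Order.min/v1]_(w : three | `[< X w >]) w.
Definition max3 (X : set three) : three :=
  \big[Order.max/v0]_(w : three | `[< X w >]) w.

Fact index_enum_three : index_enum 'I_3 = [:: v0; vhalf; v1].
Proof.
apply: (inj_map val_inj); rewrite /index_enum unlock.
by rewrite -[Finite.enum _]enumT val_enum_ord.
Qed.

Fact min3E (X : set three) :
  min3 X = if `[< X v0 >] then v0 else if `[< X vhalf >] then vhalf else v1.
Proof.
rewrite /min3 index_enum_three !big_cons big_nil.
by apply: val_inj; do 3! case: ifP => _.
Qed.

Fact max3E (X : set three) :
  max3 X = if `[< X v1 >] then v1 else if `[< X vhalf >] then vhalf else v0.
Proof.
rewrite /max3 index_enum_three !big_cons big_nil.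
by apply: val_inj; do 3! case: ifP => _.
Qed.

Definition atom_value (A : approx_space) (X : set A) (u : A) : three :=
  if `[< lower_approx X u >] then v1
  else if `[< upper_approx X u >] then vhalf
  else v0.

Fixpoint valuation L (phi : form L) (I : rough_interp L) : three :=
  match phi with
  | Atom R xs => atom_value (rel_interp (r:=I) (R:=R)) (map_tuple (assign I) xs)
  | Bot => v0
  | And a b => Order.min (valuation a I) (valuation b I)
  | Or a b => Order.max (valuation a I) (valuation b I)
  | Neg a => neg3 (valuation a I)
  | Dneg a => D3 (valuation a I)
  | All x a => min3 (range (fun u : universe I => valuation a (upd x u)))
  | Ex x a => max3 (range (fun u : universe I => valuation a (upd x u)))
  end.

Definition entails L (G : set (form L)) (a : form L) : Prop :=
  forall I : rough_interp L,
    (min3 [set valuation g I | g in G] <= valuation a I)%O.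

(* Main.v *)
Require Import Defs.
From mathcomp Require Import all_boot all_order.
From mathcomp Require Import boolp classical_sets filter.
From Stdlib Require Import RelationClasses.
From Stdlib Require List.

Set Implicit Arguments.
Unset Strict Implicit.
Unset Printing Implicit Defensive.

Import Order.TTheory.
Local Open Scope classical_set_scope.

(** Soundness is an induction on derivations. Completeness rests on three ideas.

    Rough interpretations and three-valued structures have the same
    consequences: a relation with values 0, 1/2, 1 becomes a rough relation once
    every point is split into two indiscernible copies ([blowup_rel],
    [entails_val3]).

    A prime theory of the logic has a three-valued reading. The Lindenbaum
    algebra is a regular double Stone algebra, in which [Dneg (Dneg a)] and
    [Neg (Neg a)] are the complemented elements nearest to [a] from below and
    from above. A prime theory settles complemented formulas classically, so [a]
    can be given the value 1 if the theory contains [Dneg (Dneg a)], 1/2 if it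
    contains [Neg (Neg a)] only, and 0 otherwise ([truth]). This commutes with
    the quantifiers when the theory has witnesses and both operations commute
    with both quantifiers; the latter holds because each of the laws [prv_all_DD],
    [prv_NN_ex], [prv_all_NN], [prv_DD_ex] is derivable, by means of regularity.
    Theories with witnesses are built by deciding one formula at a time, on the
    left or on the right of an underivable pair. Refuting a universal formula on
    the right requires the constant domain principle, which regularity yields
    too ([prv_const_domain], [saturation]).

    Variables serve as witnesses, which suffices for one formula. Finitely many
    assumptions are moved into the conclusion by a definable implication ([imp]),
    and free variables are closed off by universal quantifiers. Arbitrary sets of
    assumptions, over a language of any cardinality, are then reached with an
    ultraproduct ([compactness]). *)

(** * The three-element chain *)

Lemma three_ind (P : three -> Prop) :
  P v0 -> P vhalf -> P v1 -> forall a, P a.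
Proof.
move=> P0 P1 P2 a; have : a \in index_enum 'I_3 by rewrite mem_index_enum.
by rewrite index_enum_three !inE => /or3P[] /eqP->.
Qed.

Lemma ge_v0 (a : three) : (v0 <= a)%O.
Proof. by elim/three_ind: a. Qed.

Lemma le_v1 (a : three) : (a <= v1)%O.
Proof. by elim/three_ind: a. Qed.

Lemma min3_le (X : set three) u : X u -> (min3 X <= u)%O.
Proof.
rewrite min3E; elim/three_ind: u => Xu; rewrite ?le_v1 ?(asboolT Xu) //.
by case: ifP.
Qed.

Lemma max3_ge (X : set three) u : X u -> (u <= max3 X)%O.
Proof.
rewrite max3E; elim/three_ind: u => Xu; rewrite ?ge_v0 ?(asboolT Xu) //.
by case: ifP.
Qed.

Lemma le_min3 (X : set three) w :
  (forall u, X u -> (w <= u)%O) -> (w <= min3 X)%O.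
Proof.
rewrite min3E => wX.
by case: asboolP => [/wX //|_]; case: asboolP => [/wX|_] //; exact: le_v1.
Qed.

Lemma max3_le (X : set three) w :
  (forall u, X u -> (u <= w)%O) -> (max3 X <= w)%O.
Proof.
rewrite max3E => Xw.
by case: asboolP => [/Xw //|_]; case: asboolP => [/Xw|_] //; exact: ge_v0.
Qed.

Lemma min3_in (X : set three) : X !=set0 -> X (min3 X).
Proof.
rewrite min3E => -[u Xu]; case: asboolP => // X0; case: asboolP => // Xh.
by elim/three_ind: u Xu.
Qed.

Lemma max3_in (X : set three) : X !=set0 -> X (max3 X).
Proof.
rewrite max3E => -[u Xu]; case: asboolP => // X0; case: asboolP => // Xh.
by elim/three_ind: u Xu.
Qed.

Lemma lt_min3 (X : set three) w :
  (w < v1)%O -> (forall u, X u -> (w < u)%O) -> (w < min3 X)%O.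
Proof.
rewrite min3E => w1 wX.
by case: asboolP => [/wX //|_]; case: asboolP => [/wX|].
Qed.

(** * Three-valued structures *)

Definition setv (T : Type) (f : nat -> T) (x : nat) (u : T) : nat -> T :=
  fun y => if y == x then u else f y.

Definition structure (L : language) (T : Type) :=
  forall R : L, (arity R).-tuple T -> three.

(** A predicate letter may here take any three-valued relation as its value, so
    that ultraproducts and canonical structures need no indiscernibility
    relation. *)
Fixpoint val3 L T (I : structure L T) (phi : form L) (f : nat -> T) : three :=
  match phi with
  | Atom R xs => I R (map_tuple f xs)
  | Bot => v0
  | And a b => Order.min (val3 I a f) (val3 I b f)
  | Or a b => Order.max (val3 I a f) (val3 I b f)
  | Neg a => neg3 (val3 I a f)
  | Dneg a => D3 (val3 I a f)
  | All x a => min3 (range (fun u => val3 I a (setv f x u)))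
  | Ex x a => max3 (range (fun u => val3 I a (setv f x u)))
  end.

Lemma setv_eq T (f : nat -> T) x u : setv f x u x = u.
Proof. by rewrite /setv eqxx. Qed.

Lemma setvv T (f : nat -> T) x u w : setv (setv f x u) x w = setv f x w.
Proof. by apply: funext => y; rewrite /setv; case: eqP. Qed.

Lemma setvC T (f : nat -> T) x y u w : x != y ->
  setv (setv f x u) y w = setv (setv f y w) x u.
Proof.
by move=> xy; apply: funext => z; rewrite /setv; case: eqP => // ->;
  rewrite eq_sym (negbTE xy).
Qed.

Section Val3.
Variables (L : language) (T : Type) (I : structure L T).

Lemma val3_fv (phi : form L) f g : {in fv phi, f =1 g} ->
  val3 I phi f = val3 I phi g.
Proof.
elim: phi f g => [R xs||a IHa b IHb|a IHa b IHb|a IHa|a IHa|x a IHa|x a IHa]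
  f g //= fg.
- by congr I; apply: val_inj => /=; apply/eq_in_map.
- by rewrite (IHa f g) ?(IHb f g) // => y yin; apply: fg; rewrite mem_cat yin ?orbT.
- by rewrite (IHa f g) ?(IHb f g) // => y yin; apply: fg; rewrite mem_cat yin ?orbT.
- by rewrite (IHa f g).
- by rewrite (IHa f g).
- congr min3; apply: eq_imagel => u _; apply: IHa => y yin.
  by rewrite /setv; case: eqP => // /eqP yx; apply: fg; rewrite mem_filter yx.
- congr max3; apply: eq_imagel => u _; apply: IHa => y yin.
  by rewrite /setv; case: eqP => // /eqP yx; apply: fg; rewrite mem_filter yx.
Qed.

Lemma val3_setv_notin (phi : form L) f x u : x \notin fv phi ->
  val3 I phi (setv f x u) = val3 I phi f.
Proof.
move=> xphi; apply: val3_fv => y yphi; rewrite /setv.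
by case: eqP => // yx; rewrite yx (negbTE xphi) in yphi.
Qed.

(** The two ways in which the eigenvariable of a quantifier rule may be chosen:
    the bound variable itself, or one not free in the matrix. *)
Lemma val3_eigen x y (a : form L) f u : y \notin fv (All x a) ->
  val3 I a (setv (setv f y u) x u) = val3 I a (setv f x u).
Proof.
rewrite /= mem_filter negb_and negbK => /orP[/eqP->|ya]; first by rewrite setvv.
have [->|yx] := eqVneq y x; first by rewrite setvv.
by rewrite setvC // val3_setv_notin.
Qed.
End Val3.

Lemma subst_notin L x y (phi : form L) : x \notin fv phi -> subst x y phi = phi.
Proof.
elim: phi => [R xs||a IHa b IHb|a IHa b IHb|a IHa|a IHa|z a IHa|z a IHa] //=.
- move=> xs_x; congr Atom; apply: val_inj => /=.
  rewrite -[RHS]map_id; apply/eq_in_map => z zxs.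
  by case: eqP => // zx; rewrite -zx zxs in xs_x.
- by rewrite mem_cat negb_or => /andP[/IHa-> /IHb->].
- by rewrite mem_cat negb_or => /andP[/IHa-> /IHb->].
- by move/IHa->.
- by move/IHa->.
- by rewrite mem_filter negb_and negbK eq_sym; case: eqP => //= _ /IHa->.
- by rewrite mem_filter negb_and negbK eq_sym; case: eqP => //= _ /IHa->.
Qed.

Lemma subst_id L x (phi : form L) : subst x x phi = phi.
Proof.
elim: phi => [R xs||a IHa b IHb|a IHa b IHb|a IHa|a IHa|z a IHa|z a IHa] //=;
  rewrite ?IHa ?IHb ?if_same //.
congr Atom; apply: val_inj => /=; rewrite -[RHS]map_id; apply: eq_map => z.
by case: eqP.
Qed.

Lemma free_for_id L x (phi : form L) : free_for x x phi.
Proof.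
elim: phi => [R xs||a IHa b IHb|a IHa b IHb|a IHa|a IHa|z a IHa|z a IHa] //=;
  rewrite IHa ?IHb // andbT; by case: eqP => //=; rewrite orbT.
Qed.

Lemma val3_subst L T (I : structure L T) x y (phi : form L) f :
  free_for y x phi -> val3 I (subst x y phi) f = val3 I phi (setv f x (f y)).
Proof.
have quant z a : (forall f, free_for y x a ->
      val3 I (subst x y a) f = val3 I a (setv f x (f y))) ->
    forall f, free_for y x (All z a) -> forall u,
    val3 I (if z == x then a else subst x y a) (setv f z u) =
    val3 I a (setv (setv f x (f y)) z u).
  move=> IHa g; rewrite /=; case: (eqVneq z x) => [-> _ u|zx /=].
    by rewrite setvv.
  case/orP; last move=> /andP[zy ya] u.
    by move=> xa u; rewrite subst_notin // setvC 1?eq_sym // [RHS]val3_setv_notin.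
  have fy : setv g z u y = g y by rewrite /setv eq_sym (negbTE zy).
  by rewrite IHa // fy setvC.
elim: phi f => [R xs||a IHa b IHb|a IHa b IHb|a IHa|a IHa|z a IHa|z a IHa] f.
- move=> _ /=; congr I; apply: val_inj => /=; rewrite -map_comp.
  by apply: eq_map => z /=; rewrite /setv; case: eqP.
- by [].
- by move=> /= /andP[ya yb]; rewrite IHa ?IHb.
- by move=> /= /andP[ya yb]; rewrite IHa ?IHb.
- by move=> /= ya; rewrite IHa.
- by move=> /= ya; rewrite IHa.
- move/(quant _ _ IHa) => q /=; congr min3; apply: eq_imagel => u _; exact: q.
- move/(quant _ _ IHa) => q /=; congr max3; apply: eq_imagel => u _; exact: q.
Qed.

(** * Rough interpretations as three-valued structures *)

Lemma valuation_val3 (L : language) (A : approx_space)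
    (rel : forall R : L, set (pow_space A (arity R))) phi (f : nat -> A) :
  valuation phi (RoughInterp rel f) =
  val3 (fun R (u : (arity R).-tuple A) =>
          @atom_value (pow_space A (arity R)) (rel R) u) phi f.
Proof.
elim: phi f => [R xs||a IHa b IHb|a IHa b IHb|a IHa|a IHa|z a IHa|z a IHa] f //=.
- by rewrite IHa IHb.
- by rewrite IHa IHb.
- by rewrite IHa.
- by rewrite IHa.
- by congr min3; apply: eq_imagel => u _; apply: IHa.
- by congr max3; apply: eq_imagel => u _; apply: IHa.
Qed.

(** Pulling the relations back along a surjection changes no value, because the
    quantifiers then range over the same values. *)
Lemma val3_surj L T T' (h : T' -> T) (I : structure L T) phi f :
  range h = setT ->
  val3 (fun R u => I R (map_tuple h u)) phi f = val3 I phi (h \o f).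
Proof.
move=> hT.
have quant a x : (forall f,
      val3 (fun R u => I R (map_tuple h u)) a f = val3 I a (h \o f)) ->
    forall f, range (fun u => val3 (fun R u => I R (map_tuple h u)) a (setv f x u))
     = range (fun u => val3 I a (setv (h \o f) x u)).
  move=> IHa g.
  have E u : val3 (fun R u => I R (map_tuple h u)) a (setv g x u) =
      val3 I a (setv (h \o g) x (h u)).
    by rewrite IHa; congr val3; apply: funext => y; rewrite /setv /=; case: eqP.
  apply/seteqP; split=> [_ [u _ <-]|_ [w _ <-]].
    by exists (h u); rewrite // E.
  have : range h w by rewrite hT.
  by case=> u _ <-; exists u; rewrite // E.
elim: phi f => [R xs||a IHa b IHb|a IHa b IHb|a IHa|a IHa|z a IHa|z a IHa] f //=.
- by congr I; apply: val_inj => /=; rewrite -map_comp.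
- by rewrite IHa IHb.
- by rewrite IHa IHb.
- by rewrite IHa.
- by rewrite IHa.
- by rewrite quant.
- by rewrite quant.
Qed.

Section Blowup.
Variables (L : language) (T : Type) (t0 : T) (I : structure L T).

Definition blowup_indisc (p q : T * bool) : Prop := p.1 = q.1.

Lemma blowup_equiv : Equivalence blowup_indisc.
Proof. by split=> [p|p q|p q r] //; rewrite /blowup_indisc => ->. Qed.

Definition blowup_space : approx_space :=
  ApproxSpace (inhabits (t0, true)) blowup_equiv.

(** The copy index of the first argument, which exists as arities are positive,
    decides membership of the tuples of value 1/2: each of them then has
    indiscernible tuples inside and outside of the relation. *)
Definition blowup_rel (R : L) : set (pow_space blowup_space (arity R)) :=
  fun u : (arity R).-tuple (T * bool) => let w := @I R (map_tuple fst u) in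
    w = v1 \/ w = vhalf /\ (tnth u (Ordinal (arity_gt0 R))).2.

Lemma blowup_atom (R : L) (u : (arity R).-tuple (T * bool)) :
  @atom_value (pow_space blowup_space (arity R)) (blowup_rel (R := R)) u =
  @I R (map_tuple fst u).
Proof.
pose flip b : (arity R).-tuple (T * bool) := map_tuple (fun p => (p.1, b)) u.
have flipE b : map_tuple fst (flip b) = map_tuple fst u.
  by apply: val_inj => /=; rewrite -map_comp; apply: eq_map.
have flip_indisc b : @pow_indisc blowup_space _ u (flip b).
  by move=> i; rewrite /flip tnth_map.
have indiscE x : @pow_indisc blowup_space _ u x -> map_tuple fst x = map_tuple fst u.
  by move=> ux; apply: eq_from_tnth => i; rewrite !tnth_map; have := ux i.
rewrite /atom_value; case: asboolP => [/(_ _ (flip_indisc false))|low].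
  by rewrite /blowup_rel flipE tnth_map; case=> [->//|[]].
case: asboolP => [[x Rx /indiscE xu]|up].
  move: Rx; rewrite /blowup_rel xu => -[w1|[] //].
  by case: low => x' /indiscE x'u; left; rewrite x'u.
have w1 : @I R (map_tuple fst u) <> v1.
  by move=> w1; apply: low => x /indiscE xu; left; rewrite xu.
have wh : @I R (map_tuple fst u) <> vhalf.
  move=> wh; apply: up; exists (flip true); last exact: flip_indisc.
  by right; rewrite flipE tnth_map.
by elim/three_ind: (@I R _) w1 wh.
Qed.
End Blowup.

Lemma entails_val3 L (G : set (form L)) (a : form L) T (I : structure L T) f :
  entails G a -> (min3 [set val3 I g f | g in G] <= val3 I a f)%O.
Proof.
move=> Ga.
pose A := blowup_space (f 0).
pose J : rough_interp L := @RoughInterp L A (@blowup_rel L T (f 0) I)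
  (fun x => (f x, true)).
have JE phi : valuation phi J = val3 I phi f.
  rewrite valuation_val3.
  have -> : (fun (R : L) (u : (arity R).-tuple A) => @atom_value (pow_space A (arity R))
      (@blowup_rel L T (f 0) I R) u) = (fun R u => I R (map_tuple fst u)).
    apply: functional_extensionality_dep => R; apply: funext => u.
    exact: blowup_atom.
  rewrite (val3_surj (h := @fst T bool)) //.
  by apply/seteqP; split=> // t _; exists (t, true).
have := Ga J; rewrite JE; congr (min3 _ <= _)%O.
by apply: eq_imagel => g _; exact: JE.
Qed.

(** * Soundness *)

(** The threshold [w] must vary along the induction: discharging [a] lowers it
    to the value of [a], and the theorems used by the elimination of [D] are
    applied at the threshold 1. *)
Lemma soundness3 L (G : set (form L)) (a : form L) : deriv G a ->
  forall T (I : structure L T) f w,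
    (forall g, G g -> (w <= val3 I g f)%O) -> (w <= val3 I a f)%O.
Proof.
move=> Ga T I; elim: G a / Ga.
- by move=> a f w; apply.
- move=> G1 G2 a b _ IHa _ IHb f w wG /=; rewrite le_min.
  by rewrite IHa ?IHb // => g Gg; apply: wG; [right|left].
- by move=> G a b _ IH f w /IH; rewrite /= le_min => /andP[].
- by move=> G a b _ IH f w /IH; rewrite /= le_min => /andP[].
- by move=> G a b _ IH f w /IH; rewrite /= le_max => ->.
- by move=> G a b _ IH f w /IH; rewrite /= le_max => ->; rewrite orbT.
- move=> G G1 G2 a b c _ IH _ IH1 _ IH2 f w wG.
  have /IH : forall g, G g -> (w <= val3 I g f)%O by move=> g Gg; apply: wG; do 2 left.
  rewrite /= le_max => /orP[wa|wb].
    apply: IH1 => g G1g; case: (pselect (g = a)) => [->//|ga].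
    by apply: wG; left; right.
  apply: IH2 => g G2g; case: (pselect (g = b)) => [->//|gb].
  by apply: wG; right.
- move=> G a _ IH f w wG /=.
  have : (Order.min w (val3 I a f) <= v0)%O.
    apply: (IH f) => g Gg; rewrite ge_min; case: (pselect (g = a)) => [->|ga].
      by rewrite lexx orbT.
    by rewrite wG.
  by elim/three_ind: (val3 I a f); elim/three_ind: w {wG}.
- move=> G1 G2 a _ IH1 _ IH2 f w wG /=.
  have := IH1 f w (fun g G1g => wG g (or_introl G1g)).
  have := IH2 f w (fun g G2g => wG g (or_intror G2g)).
  by rewrite /=; elim/three_ind: (val3 I a f); elim/three_ind: w {wG}.
- by move=> G a _ IH f w /IH /= w0; apply: le_trans w0 (ge_v0 _).
- move=> a f w _ /=.
  by elim/three_ind: (val3 I a f); elim/three_ind: w.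
- move=> G a b _ IH1 _ IH2 f w /IH1 /=.
  have /= := IH2 f v1 (fun g F => match F with end).
  by elim/three_ind: (val3 I a f); elim/three_ind: (val3 I b f); elim/three_ind: w.
- move=> a f w _ /=.
  by elim/three_ind: (val3 I a f); elim/three_ind: w.
- move=> G1 G2 a _ IH1 _ IH2 f w wG /=.
  have := IH1 f w (fun g G1g => wG g (or_introl G1g)).
  have := IH2 f w (fun g G2g => wG g (or_intror G2g)).
  by rewrite /=; elim/three_ind: (val3 I a f); elim/three_ind: w {wG}.
- move=> G1 G2 a b _ IH1 _ IH2 f w wG /=.
  have := IH1 f w (fun g G1g => wG g (or_introl G1g)).
  have := IH2 f w (fun g G2g => wG g (or_intror G2g)).
  by rewrite /=; elim/three_ind: (val3 I a f); elim/three_ind: (val3 I b f);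
    elim/three_ind: w {wG}.
- move=> G x y a yxa ya yG _ IH f w wG /=; apply: le_min3 => _ [u _ <-].
  have : (w <= val3 I (subst x y a) (setv f y u))%O.
    by apply: IH => g Gg; rewrite val3_setv_notin ?wG ?yG.
  by rewrite val3_subst // setv_eq val3_eigen.
- move=> G x y a yxa _ IH f w /IH /= /le_trans; apply.
  by rewrite val3_subst //; apply: min3_le; exists (f y).
- move=> G x y a yxa _ IH f w /IH /= /le_trans; apply.
  by rewrite val3_subst //; apply: max3_ge; exists (f y).
- move=> G1 G2 x y a c yxa ya yc yG _ IH1 _ IH2 f w wG.
  have /= := IH1 f w (fun g G1g => wG g (or_introl G1g)).
  have [|u _ <- wu] := @max3_in (range (fun u => val3 I a (setv f x u))).
    by exists (val3 I a (setv f x (f 0))), (f 0).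
  rewrite -(val3_setv_notin I f u yc); apply: IH2 => g G2g.
  case: (pselect (g = subst x y a)) => [->|ga].
    by rewrite val3_subst // setv_eq val3_eigen.
  by rewrite val3_setv_notin ?yG //; apply: wG; right.
Qed.

Lemma soundness L (G : set (form L)) (a : form L) :
  derivable G a -> entails G a.
Proof.
move=> [G0 /soundness3 G0a G0G] [A rel f].
rewrite valuation_val3; apply: G0a => g /G0G Gg.
by rewrite -valuation_val3; apply: min3_le; exists g.
Qed.

(** * Compactness *)

Section Ultraproduct.
Variables (L : language) (J T : Type) (U : set_system J).
Hypothesis UU : UltraFilter U.
Variable I : J -> structure L T.

(** The limit of [h] along the ultrafilter, which exists as there are finitely
    many values. *)
Definition ulim (h : J -> three) : three :=
  if `[< U [set j | h j = v0] >] then v0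
  else if `[< U [set j | h j = vhalf] >] then vhalf else v1.

Lemma ulimP (h : J -> three) : U [set j | h j = ulim h].
Proof.
rewrite /ulim; case: asboolP => // n0; case: asboolP => // nh.
have [//|U0] := in_ultra_setVsetC [set j | h j = v0] UU.
have [//|Uh] := in_ultra_setVsetC [set j | h j = vhalf] UU.
apply: filterS (filterI U0 Uh) => j /= [].
by elim/three_ind: (h j).
Qed.

(** As there is no equality in the language, the product need not be divided by
    the almost-everywhere equality. *)
Definition ultraproduct : structure L (J -> T) :=
  fun R u => ulim (fun j => I j (map_tuple (fun g => g j) u)).

(** For the quantifiers: minima and maxima in the chain are attained, so the
    coordinatewise optimal elements form an optimal element of the product. *)
Lemma los phi (f : nat -> J -> T) :
  U [set j | val3 (I j) phi (f^~ j) = val3 ultraproduct phi f].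
Proof.
have setvj (g : nat -> J -> T) x u j : setv g x u ^~ j = setv (g^~ j) x (u j).
  by apply: funext => y; rewrite /setv; case: eqP.
elim: phi f => [R xs||a IHa b IHb|a IHa b IHb|a IHa|a IHa|x a IHa|x a IHa] f /=.
- pose h j := @I j R (map_tuple (fun g => g j) (map_tuple f xs)).
  apply: filterS (ulimP h) => j /= hj; rewrite -[RHS]/(ulim h) -hj; congr (@I j R _).
  by apply: val_inj => /=; rewrite -map_comp.
- by apply: filterS (@filterT _ U _).
- by apply: filterS (filterI (IHa f) (IHb f)) => j /= [-> ->].
- by apply: filterS (filterI (IHa f) (IHb f)) => j /= [-> ->].
- by apply: filterS (IHa f) => j /= ->.
- by apply: filterS (IHa f) => j /= ->.
- set m := min3 _.
  pose h j := min3 (range (fun t => val3 (I j) a (setv (f^~ j) x t))).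
  have /choice[u hu] : forall j, exists t,
      val3 (I j) a (setv (f^~ j) x t) = h j.
    move=> j.
    have [|t _ tE] := @min3_in (range (fun t => val3 (I j) a (setv (f^~ j) x t))).
      by exists (val3 (I j) a (setv (f^~ j) x (f x j))), (f x j).
    by exists t.
  suff <- : ulim h = m by exact: ulimP.
  apply: le_anti; apply/andP; split.
    have [|u' _ u'E] := @min3_in (range (fun u => val3 ultraproduct a (setv f x u))).
      by exists (val3 ultraproduct a (setv f x u)), u.
    have [j [/= <-]] := filter_ex (filterI (ulimP h) (IHa (setv f x u'))).
    rewrite /m -u'E => <-; apply: min3_le; exists (u' j) => //.
    by rewrite setvj.
  have [j [/= <-]] := filter_ex (filterI (ulimP h) (IHa (setv f x u))).
  by rewrite setvj hu => ->; apply: min3_le; exists u.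
- set m := max3 _.
  pose h j := max3 (range (fun t => val3 (I j) a (setv (f^~ j) x t))).
  have /choice[u hu] : forall j, exists t,
      val3 (I j) a (setv (f^~ j) x t) = h j.
    move=> j.
    have [|t _ tE] := @max3_in (range (fun t => val3 (I j) a (setv (f^~ j) x t))).
      by exists (val3 (I j) a (setv (f^~ j) x (f x j))), (f x j).
    by exists t.
  suff <- : ulim h = m by exact: ulimP.
  apply: le_anti; apply/andP; split.
    have [j [/= <-]] := filter_ex (filterI (ulimP h) (IHa (setv f x u))).
    by rewrite setvj hu => ->; apply: max3_ge; exists u.
  have [|u' _ u'E] := @max3_in (range (fun u => val3 ultraproduct a (setv f x u))).
    by exists (val3 ultraproduct a (setv f x u)), u.
  have [j [/= <-]] := filter_ex (filterI (ulimP h) (IHa (setv f x u'))).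
  rewrite /m -u'E => <-; apply: max3_ge; exists (u' j) => //.
  by rewrite setvj.
Qed.
End Ultraproduct.

Definition refutes L T (I : structure L T) (f : nat -> T) (G : set (form L))
    (a : form L) : Prop :=
  (val3 I a f < v1)%O /\ forall g, G g -> (val3 I a f < val3 I g f)%O.

Definition listset (X : Type) (s : seq X) : set X := fun g => List.In g s.

(** The index set is that of the finite lists of formulas; the ultrafilter
    contains, for each assumption, the cone of the lists that include it. *)
Lemma compactness L T (G : set (form L)) (a : form L) :
  (forall s : seq (form L), listset s `<=` G ->
     exists (I : structure L T) f, refutes I f (listset s) a) ->
  exists T' (I : structure L T') f, refutes I f G a.
Proof.
move=> Gfin.
have /choice[M HM] : forall s, exists M : structure L T * (nat -> T),
    listset s `<=` G -> refutes M.1 M.2 (listset s) a.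
  have [I0 [f0 _]] : exists (I : structure L T) f, refutes I f (listset [::]) a.
    by apply: Gfin.
  move=> s.
  have [/Gfin[I [f IfP]]|nsG] := pselect (listset s `<=` G).
    by exists (I, f).
  by exists (I0, f0).
pose cones : set_system (seq (form L)) := [set X | exists2 s0, listset s0 `<=` G &
  forall s, listset s `<=` G -> listset s0 `<=` listset s -> X s].
have cones_proper : ProperFilter cones.
  split; first by case=> s0 s0G /(_ s0 s0G); apply.
  split.
  - by exists [::].
  - move=> X Y [s sG Xs] [t tG Yt]; exists (s ++ t).
      by move=> g gst; have [/sG|/tG] := List.in_app_or _ _ _ gst.
    move=> r rG str; split.
      by apply: Xs => // g gs; apply: str; apply: List.in_or_app; left.
    by apply: Yt => // g gt; apply: str; apply: List.in_or_app; right.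
  - by move=> X Y XY [s sG Xs]; exists s => // r rG sr; apply: XY; apply: Xs.
have [U [UU conesU]] := ultraFilterLemma cones_proper.
pose I := ultraproduct U (fun s => (M s).1).
pose f x s := (M s).2 x.
exists (seq (form L) -> T), I, f.
have los_at phi : U [set s | val3 (M s).1 phi (M s).2 = val3 I phi f].
  exact: los UU _ phi f.
have Ubelow s0 : listset s0 `<=` G ->
    U [set s | listset s `<=` G /\ listset s0 `<=` listset s].
  by move=> s0G; apply: conesU; exists s0.
split.
  have [|s [/= <- [sG _]]] := filter_ex (filterI (los_at a) (Ubelow [::] _)); first by [].
  by have [] := HM s sG.
move=> g Gg; have g1 : listset [:: g] `<=` G by move=> _ [<-|[]].
have [s [/= <- [<- [sG gs]]]] :=
  filter_ex (filterI (los_at a) (filterI (los_at g) (Ubelow _ g1))).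
by have [_] := HM s sG; apply; apply: gs; left.
Qed.

(** * Natural deduction from finite contexts *)

Definition prv L (s : seq (form L)) (a : form L) : Prop := derivable (listset s) a.

Section Rules.
Variable L : language.
Implicit Types (a b c w : form L) (s t : seq (form L)).

Lemma prv_hyp s a : List.In a s -> prv s a.
Proof. by move=> sa; exists [set a]; [exact: d_assume|move=> _ ->]. Qed.

Lemma prv_sub s t a : listset s `<=` listset t -> prv s a -> prv t a.
Proof. by move=> st [G Ga Gs]; exists G => // g /Gs /st. Qed.

Lemma prv_thm s a : prv [::] a -> prv s a.
Proof. by apply: prv_sub => g []. Qed.

Lemma prv_andI s a b : prv s a -> prv s b -> prv s (And a b).
Proof.
move=> [G Ga Gs] [H Hb Hs]; exists (G `|` H); first exact: d_andI.
by move=> g [/Gs|/Hs].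
Qed.

Lemma prv_andE1 s a b : prv s (And a b) -> prv s a.
Proof. by move=> [G Ga Gs]; exists G => //; exact: d_andE1 Ga. Qed.

Lemma prv_andE2 s a b : prv s (And a b) -> prv s b.
Proof. by move=> [G Ga Gs]; exists G => //; exact: d_andE2 Ga. Qed.

Lemma prv_orI1 s a b : prv s a -> prv s (Or a b).
Proof. by move=> [G Ga Gs]; exists G => //; exact: d_orI1. Qed.

Lemma prv_orI2 s a b : prv s b -> prv s (Or a b).
Proof. by move=> [G Ga Gs]; exists G => //; exact: d_orI2. Qed.

Lemma prv_orE s a b c :
  prv s (Or a b) -> prv (a :: s) c -> prv (b :: s) c -> prv s c.
Proof.
move=> [G Gab Gs] [G1 G1c G1s] [G2 G2c G2s].
exists (G `|` (G1 `\ a) `|` (G2 `\ b)); first exact: d_orE G1c G2c.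
by move=> g [[/Gs //|[/G1s[ag|//] /(_ (esym ag))]]|[/G2s[bg|//] /(_ (esym bg))]].
Qed.

(** Disjunction elimination makes cut admissible; there is no implication to
    derive it from. *)
Lemma prv_cut s a b : prv s a -> prv (a :: s) b -> prv s b.
Proof. by move=> sa ab; exact: (prv_orE (prv_orI1 _ sa) ab ab). Qed.

Lemma prv_negI s a : prv (a :: s) Bot -> prv s (Neg a).
Proof.
move=> [G Ga Gs]; exists (G `\ a); first exact: d_negI.
by move=> g [/Gs[ag|//] /(_ (esym ag))].
Qed.

Lemma prv_easq s b : prv s Bot -> prv s b.
Proof. by move=> [G G0 Gs]; exists G => //; exact: d_easq. Qed.

Lemma prv_absurd s a b : prv s a -> prv s (Neg a) -> prv s b.
Proof.
move=> [G Ga Gs] [H Hb Hs]; apply: prv_easq.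
exists (G `|` H); first exact: d_negE Ga Hb.
by move=> g [/Gs|/Hs].
Qed.

Lemma prv_DI s a : prv s (Or a (Dneg a)).
Proof. by exists set0 => //; exact: d_DI. Qed.

Lemma prv_DE s a b : prv [::] (Or a b) -> prv s (Dneg a) -> prv s b.
Proof.
move=> [G0 G0ab G00] [G Ga Gs]; exists G => //; apply: d_DE Ga _.
by have <- : G0 = set0 by apply/seteqP; split=> // g /G00.
Qed.

Lemma prv_S s a : prv s (Or (Neg a) (Neg (Neg a))).
Proof. by exists set0 => //; exact: d_S. Qed.

Lemma prv_cS s a b : prv s (Dneg a) -> prv s (Dneg (Dneg a)) -> prv s b.
Proof.
move=> [G Ga Gs] [H Hb Hs]; apply: prv_easq.
exists (G `|` H); first exact: d_cS Ga Hb.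
by move=> g [/Gs|/Hs].
Qed.

Lemma prv_Reg s a b : prv s a -> prv s (Dneg a) -> prv s (Or b (Neg b)).
Proof.
move=> [G Ga Gs] [H Hb Hs].
exists (G `|` H); first exact: d_Reg Ga Hb.
by move=> g [/Gs|/Hs].
Qed.

Lemma prv_allI s x y a : free_for y x a -> y \notin fv (All x a) ->
  (forall g, List.In g s -> y \notin fv g) ->
  prv s (subst x y a) -> prv s (All x a).
Proof.
move=> yxa ya ys [G Ga Gs]; exists G => //; apply: d_allI yxa ya _ Ga.
by move=> g /Gs /ys.
Qed.

Lemma prv_allE s x y a : free_for y x a -> prv s (All x a) -> prv s (subst x y a).
Proof. by move=> yxa [G Ga Gs]; exists G => //; exact: d_allE. Qed.

Lemma prv_exI s x y a : free_for y x a -> prv s (subst x y a) -> prv s (Ex x a).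
Proof. by move=> yxa [G Ga Gs]; exists G => //; exact: d_exI Ga. Qed.

Lemma prv_exE s x y a c : free_for y x a -> y \notin fv (Ex x a) ->
  y \notin fv c -> (forall g, List.In g s -> y \notin fv g) ->
  prv s (Ex x a) -> prv (subst x y a :: s) c -> prv s c.
Proof.
move=> yxa ya yc ys [G Ga Gs] [H Hc Hs].
have Hs' : H `\ subst x y a `<=` listset s.
  by move=> g [/Hs[ag|//] /(_ (esym ag))].
exists (G `|` (H `\ subst x y a)); first by apply: d_exE => // g /Hs' /ys.
by move=> g [/Gs|/Hs'].
Qed.
End Rules.

Ltac hyp := apply: prv_hyp; simpl; repeat first [left; reflexivity | right].

(** * Propositional theorems *)

Section Propositional.
Variable L : language.
Implicit Types (a b c w : form L) (s t : seq (form L)).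

Lemma prv_trans a b c : prv [:: a] b -> prv [:: b] c -> prv [:: a] c.
Proof.
move=> ab bc; apply: (prv_cut ab); apply: prv_sub bc => g [<-|[]]; by left.
Qed.

Lemma prv_refl a : prv [:: a] a.
Proof. by hyp. Qed.

Lemma prv_neg_mono s a b : prv [:: a] b -> prv s (Neg b) -> prv s (Neg a).
Proof.
move=> ab sb; apply: (prv_cut sb); apply: prv_negI.
apply: (@prv_absurd _ _ b); last by hyp.
by apply: prv_sub ab => g [<-|[]]; left.
Qed.

Lemma prv_D_mono s a b : prv [:: a] b -> prv s (Dneg b) -> prv s (Dneg a).
Proof.
move=> ab; apply: prv_DE; apply: (prv_orE (prv_DI _ a)); last by apply: prv_orI2; hyp.
exact: prv_orI1.
Qed.

Lemma prv_NN_mono s a b :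
  prv [:: a] b -> prv s (Neg (Neg a)) -> prv s (Neg (Neg b)).
Proof. by move=> ab; apply: prv_neg_mono; apply: (prv_neg_mono ab); hyp. Qed.

Lemma prv_DD_mono s a b :
  prv [:: a] b -> prv s (Dneg (Dneg a)) -> prv s (Dneg (Dneg b)).
Proof. by move=> ab; apply: prv_D_mono; apply: (prv_D_mono ab); hyp. Qed.

Lemma prv_DDE s a : prv s (Dneg (Dneg a)) -> prv s a.
Proof.
move=> sa; apply: (prv_cut sa); apply: (prv_orE (prv_DI _ a)); first by hyp.
by apply: (@prv_cS _ _ a); hyp.
Qed.

Lemma prv_NNI s a : prv s a -> prv s (Neg (Neg a)).
Proof.
by move=> sa; apply: (prv_cut sa); apply: prv_negI; apply: (@prv_absurd _ _ a); hyp.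
Qed.

Lemma prv_NNN s a : prv s (Neg (Neg (Neg a))) -> prv s (Neg a).
Proof. by apply: prv_neg_mono; apply: prv_NNI; hyp. Qed.

Lemma prv_DDN s a : prv s (Neg a) -> prv s (Dneg (Dneg (Neg a))).
Proof.
move=> sa; apply: (prv_cut sa); apply: (prv_orE (prv_DI _ (Dneg (Neg a)))); last by hyp.
apply: (@prv_absurd _ _ (Neg a)); first by hyp.
by apply: (@prv_DE _ _ (Neg a)); [exact: prv_S|hyp].
Qed.

Lemma prv_DDD s a : prv s (Dneg a) -> prv s (Dneg (Dneg (Dneg a))).
Proof.
move=> sa; apply: (prv_cut sa).
apply: (prv_orE (prv_DI _ (Dneg (Dneg a)))); last by hyp.
by apply: (@prv_cS _ _ a); hyp.
Qed.

Lemma prv_NND s a : prv s (Neg (Neg (Dneg a))) -> prv s (Dneg a).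
Proof.
move=> sa; apply: (prv_cut sa).
apply: (prv_orE (prv_DI _ (Dneg a))); first by hyp.
apply: (@prv_absurd _ _ (Neg (Dneg a))); last by hyp.
by apply: prv_negI; apply: (@prv_cS _ _ a); hyp.
Qed.

Lemma prv_NN_and s a b :
  prv s (Neg (Neg a)) -> prv s (Neg (Neg b)) -> prv s (Neg (Neg (And a b))).
Proof.
move=> sa sb; apply: prv_negI; apply: (@prv_absurd _ _ (Neg a)); last first.
  by apply: prv_sub sa => g; right.
apply: prv_negI; apply: (@prv_absurd _ _ (Neg b)); last first.
  by apply: prv_sub sb => g; right; right.
apply: prv_negI; apply: (@prv_absurd _ _ (And a b)); last by hyp.
by apply: prv_andI; hyp.
Qed.

Lemma prv_NN_or s a b :
  prv s (Neg (Neg (Or a b))) -> prv s (Or (Neg (Neg a)) (Neg (Neg b))).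
Proof.
move=> sab; apply: (prv_cut sab).
apply: (prv_orE (prv_S _ a)); last by apply: prv_orI1; hyp.
apply: (prv_orE (prv_S _ b)); last by apply: prv_orI2; hyp.
apply: (@prv_absurd _ _ (Neg (Or a b))); last by hyp.
apply: prv_negI; apply: (@prv_orE _ _ a b); first by hyp.
  by apply: (@prv_absurd _ _ a); hyp.
by apply: (@prv_absurd _ _ b); hyp.
Qed.

(** From [Dneg (And a b)] one obtains [Or (Dneg a) (Dneg b)], by the theorem
    [Or (And a b) (Or (Dneg a) (Dneg b))]. *)
Lemma prv_DD_and s a b :
  prv s (Dneg (Dneg a)) -> prv s (Dneg (Dneg b)) -> prv s (Dneg (Dneg (And a b))).
Proof.
move=> sa sb.
apply: (prv_orE (prv_DI _ (Dneg (And a b)))); last by hyp.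
have D_and : prv [::] (Or (And a b) (Or (Dneg a) (Dneg b))).
  apply: (prv_orE (prv_DI _ a)); last by apply: prv_orI2; apply: prv_orI1; hyp.
  apply: (prv_orE (prv_DI _ b)); last by apply: prv_orI2; apply: prv_orI2; hyp.
  by apply: prv_orI1; apply: prv_andI; hyp.
apply: (@prv_orE _ _ (Dneg a) (Dneg b)).
- by apply: (prv_DE D_and); hyp.
- apply: (@prv_cS _ _ a); first by hyp.
  by apply: prv_sub sa => g; right; right.
- apply: (@prv_cS _ _ b); first by hyp.
  by apply: prv_sub sb => g; right; right.
Qed.

(** [Dneg (Dneg a)] is the greatest complemented element below [a], so a theorem
    [Or a w] survives necessitation of one side. *)
Lemma prv_box a w : prv [::] (Or a w) -> prv [::] (Or (Dneg (Dneg a)) w).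
Proof.
move=> aw; apply: (prv_orE (prv_DI _ (Dneg a))); last by apply: prv_orI1; hyp.
by apply: prv_orI2; apply: (prv_DE aw); hyp.
Qed.

(** Necessitating the first two disjuncts of [Or a (Or b (Dneg (Or a b)))] in turn
    makes [Dneg (Dneg _)] commute with [Or]. *)
Lemma prv_DD_or s a b :
  prv s (Dneg (Dneg (Or a b))) -> prv s (Or (Dneg (Dneg a)) (Dneg (Dneg b))).
Proof.
move=> sab; apply: (prv_cut sab).
have DD_a : prv [::] (Or (Dneg (Dneg a)) (Or b (Dneg (Or a b)))).
  apply: prv_box; apply: (prv_orE (prv_DI _ (Or a b))); last first.
    by do 2!apply: prv_orI2; hyp.
  apply: (@prv_orE _ _ a b); [hyp|apply: prv_orI1; hyp|].
  by apply: prv_orI2; apply: prv_orI1; hyp.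
have DD_b : prv [::] (Or (Dneg (Dneg b)) (Or (Dneg (Dneg a)) (Dneg (Or a b)))).
  apply: prv_box; apply: (prv_orE DD_a); first by apply: prv_orI2; apply: prv_orI1; hyp.
  apply: (@prv_orE _ _ b (Dneg (Or a b))); [hyp|apply: prv_orI1; hyp|].
  by do 2!apply: prv_orI2; hyp.
apply: (prv_orE (prv_thm _ DD_b)); first by apply: prv_orI2; hyp.
apply: (@prv_orE _ _ (Dneg (Dneg a)) (Dneg (Or a b))); first by hyp.
  by apply: prv_orI1; hyp.
by apply: (@prv_cS _ _ (Or a b)); hyp.
Qed.

(** Katrinak's implication of regular double Stone algebras: at the values of
    the three-element chain it is 1 exactly where [a <= b]. *)
Definition imp a b : form L :=
  And (Or (Neg a) (Neg (Neg b)))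
      (Or (Dneg (Or a (Neg a))) (Or (Neg a) (Or b (Neg b)))).

Lemma prv_imp a b : prv [::] (imp a b) -> prv [:: a] b.
Proof.
move=> ab; have {}ab : prv [:: a] (imp a b) by exact: prv_thm.
have b_or s : prv (Or b (Neg b) :: Neg (Neg b) :: s) b.
  apply: (@prv_orE _ _ b (Neg b)); [hyp|hyp|].
  by apply: (@prv_absurd _ _ (Neg b)); hyp.
apply: (prv_orE (prv_andE1 ab)); first by apply: (@prv_absurd _ _ a); hyp.
apply: (prv_cut (prv_sub _ (prv_andE2 ab))); first by move=> g; right.
apply: (@prv_orE _ _ (Dneg (Or a (Neg a))) (Or (Neg a) (Or b (Neg b)))); first by hyp.
  apply: (prv_cut (a := Or b (Neg b))).
    apply: (@prv_Reg _ _ (Or a (Neg a))); last by hyp.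
    by apply: prv_orI1; hyp.
  apply: (prv_sub _ (b_or [::])) => g /= [<-|[<-|[]]]; first by left.
  by do 3 right; left.
apply: (@prv_orE _ _ (Neg a) (Or b (Neg b))); first by hyp.
  by apply: (@prv_absurd _ _ a); hyp.
apply: (prv_sub _ (b_or [::])) => g /= [<-|[<-|[]]]; first by left.
by do 3 right; left.
Qed.

Lemma val3_imp T (I : structure L T) a b f :
  (val3 I (imp a b) f < v1)%O -> (val3 I b f < val3 I a f)%O.
Proof.
by rewrite /=; elim/three_ind: (val3 I a f); elim/three_ind: (val3 I b f).
Qed.

Definition conj s : form L := foldr (@And L) (Neg Bot) s.

Lemma prv_conj s a : prv [:: conj s] a -> prv s a.
Proof.
move=> ca; apply: (@prv_cut _ _ (conj s)); last first.
  by apply: prv_sub ca => g [<-|[]]; left.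
elim: s {ca} => [|b s IHs] /=; first by apply: prv_negI; hyp.
apply: prv_andI; first by hyp.
by apply: prv_sub IHs => g; right.
Qed.

Lemma val3_conj T (I : structure L T) s f b : List.In b s ->
  (val3 I (conj s) f <= val3 I b f)%O.
Proof.
elim: s => //= c s IHs [->|/IHs sb]; first by rewrite ge_min lexx.
by rewrite ge_min sb orbT.
Qed.
End Propositional.

(** * Quantifier theorems *)

Fixpoint bv L (phi : form L) : seq nat :=
  match phi with
  | Atom _ _ | Bot => [::]
  | And a b | Or a b => bv a ++ bv b
  | Neg a | Dneg a => bv a
  | All x a | Ex x a => x :: bv a
  end.

Lemma free_for_bv L x y (a : form L) : y \notin bv a -> free_for y x a.
Proof.
elim: a => //= [a IHa b IHb|a IHa b IHb|z a IHa|z a IHa].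
- by rewrite mem_cat negb_or => /andP[/IHa-> /IHb->].
- by rewrite mem_cat negb_or => /andP[/IHa-> /IHb->].
- by rewrite inE negb_or eq_sym => /andP[-> /IHa->]; rewrite !orbT.
- by rewrite inE negb_or eq_sym => /andP[-> /IHa->]; rewrite !orbT.
Qed.

Lemma exists_fresh N (l : seq nat) : exists2 y, N <= y & y \notin l.
Proof.
exists (N + (\max_(i <- l) i).+1); first exact: leq_addr.
apply/negP => yl; have := @leq_bigmax_seq _ l xpredT (fun i : nat => i) _ yl isT.
by rewrite leqNgt addnS ltnS leq_addl.
Qed.

Lemma exists_eigen L N x (a : form L) (l : seq nat) :
  exists y, [/\ N <= y, free_for y x a, y \notin fv (All x a) & y \notin l].
Proof.
have [y Ny] := exists_fresh N (fv a ++ bv a ++ l).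
rewrite !mem_cat !negb_or => /and3P[ya yba yl]; exists y.
by split=> //; [exact: free_for_bv|rewrite /= mem_filter negb_and ya orbT].
Qed.

Section Quantifiers.
Variable L : language.
Implicit Types (a c d : form L).

(** The constant domain principle, as a rule. Either [Dneg c] holds next to [c],
    and then regularity makes [d] decidable; or [c] is necessary, and then so is
    one of the disjuncts, which is the instance of [a] as soon as [Dneg d]. *)
Lemma prv_const_domain c d x y a :
  free_for y x a -> y \notin fv (All x a) -> y \notin fv c -> y \notin fv d ->
  prv [:: c] (Or (subst x y a) d) -> prv [:: c] (Or (All x a) d).
Proof.
move=> yxa ya yc yd cad.
apply: (prv_orE (prv_DI _ (Dneg c))).
  apply: (@prv_orE _ _ d (Neg d)).
  - by apply: (@prv_Reg _ _ c); hyp.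
  - by apply: prv_orI2; hyp.
  apply: prv_orI1; apply: (@prv_allI _ _ _ y) => //.
    by move=> g /= [<-|[<-|[<-|[]]]].
  apply: (@prv_orE _ _ (subst x y a) d); last by apply: (@prv_absurd _ _ d); hyp.
    by apply: prv_sub cad => g [<-|[]] /=; right; right; left.
  by hyp.
apply: (prv_orE (prv_DI _ d)); first by apply: prv_orI2; hyp.
apply: prv_orI1; apply: (@prv_allI _ _ _ y) => //.
  by move=> g /= [<-|[<-|[<-|[]]]].
apply: (@prv_orE _ _ (Dneg (Dneg (subst x y a))) (Dneg (Dneg d))).
- by apply: prv_DD_or; apply: (prv_DD_mono cad); hyp.
- by apply: prv_DDE; hyp.
- by apply: (@prv_cS _ _ d); hyp.
Qed.

Lemma prv_const_domain0 d x y a :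
  free_for y x a -> y \notin fv (All x a) -> y \notin fv d ->
  prv [::] (Or (subst x y a) d) -> prv [::] (Or (All x a) d).
Proof.
move=> yxa ya yd ad.
have top : prv [::] (Neg (@Bot L)) by apply: prv_negI; hyp.
apply: (prv_cut top); apply: (@prv_const_domain _ _ _ y) => //.
exact: prv_thm.
Qed.

(** By constant domains, [Or (All x a) (Ex x (Dneg a))] is a theorem, so that
    [Dneg (All x a)] yields [Ex x (Dneg a)]. *)
Lemma prv_all_DD s x a :
  prv s (All x (Dneg (Dneg a))) -> prv s (Dneg (Dneg (All x a))).
Proof.
move=> sa; apply: (prv_cut (a := All x (Dneg (Dneg a)))) => //.
apply: (@prv_sub _ [:: All x (Dneg (Dneg a))]) => [g [<-|[]]|]; first by left.
have [y [_ yxa ya _]] := exists_eigen 0 x a [::].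
have all_or_ex : prv [::] (Or (All x a) (Ex x (Dneg a))).
  apply: (@prv_const_domain0 _ _ y) => //.
  apply: (prv_orE (prv_DI _ (subst x y a))); first by apply: prv_orI1; hyp.
  by apply: prv_orI2; apply: (@prv_exI _ _ _ y (Dneg a)) => //; hyp.
apply: (prv_orE (prv_DI _ (Dneg (All x a)))); last by hyp.
apply: (@prv_exE _ _ x y (Dneg a)) => //.
- by move=> g [<-|[<-|[]]].
- by apply: (prv_DE all_or_ex); hyp.
apply: (@prv_cS _ _ (subst x y a)); first by hyp.
by apply: (@prv_allE _ _ x y (Dneg (Dneg a))) => //; hyp.
Qed.

(** By constant domains, [Or (Neg a) (Neg (Neg a))] gives
    [Or (All x (Neg a)) (Ex x (Neg (Neg a)))]. *)
Lemma prv_NN_ex s x a :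
  prv s (Neg (Neg (Ex x a))) -> prv s (Ex x (Neg (Neg a))).
Proof.
move=> sa; apply: (prv_cut sa).
have [y [_ yxa ya _]] := exists_eigen 0 x a [::].
have all_or_ex : prv [::] (Or (All x (Neg a)) (Ex x (Neg (Neg a)))).
  apply: (@prv_const_domain0 _ _ y) => //.
  apply: (prv_orE (prv_S _ (subst x y a))); first by apply: prv_orI1; hyp.
  by apply: prv_orI2; apply: (@prv_exI _ _ _ y (Neg (Neg a))) => //; hyp.
apply: (prv_orE (prv_thm _ all_or_ex)); last by hyp.
apply: (@prv_absurd _ _ (Neg (Ex x a))); last by hyp.
apply: (@prv_sub _ [:: All x (Neg a)]) => [g [<-|[]]|]; first by left.
apply: prv_negI; apply: (@prv_exE _ _ x y a) => //.
- by move=> g [<-|[<-|[]]].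
- by hyp.
apply: (@prv_absurd _ _ (subst x y a)); first by hyp.
by apply: (@prv_allE _ _ x y (Neg a)) => //; hyp.
Qed.

(** Suppose [Neg (All x a)]. An instance of [a] that is not necessary lies, being
    dense, strictly between; regularity then makes every formula decidable, so
    every instance of [a] holds. *)
Lemma prv_all_NN s x a :
  prv s (All x (Neg (Neg a))) -> prv s (Neg (Neg (All x a))).
Proof.
move=> sa; apply: (prv_cut (a := All x (Neg (Neg a)))) => //.
apply: (@prv_sub _ [:: All x (Neg (Neg a))]) => [g [<-|[]]|]; first by left.
have [y [_ yxa ya _]] := exists_eigen 0 x a [::].
apply: prv_negI; apply: (@prv_absurd _ _ (All x a)); last by hyp.
apply: (@prv_allI _ _ _ y) => //; first by move=> g [<-|[<-|[]]].
apply: (prv_orE (prv_DI _ (subst x y a))); first by hyp.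
apply: (@prv_absurd _ _ (Neg (subst x y a))); last first.
  by apply: (@prv_allE _ _ x y (Neg (Neg a))) => //; hyp.
apply: prv_negI; apply: (@prv_absurd _ _ (All x a)); last by hyp.
have [z [_ zxa za zy]] := exists_eigen 0 x a (fv (subst x y a)).
apply: (@prv_allI _ _ _ z) => //; first by move=> g [<-|[<-|[<-|[<-|[]]]]].
apply: (@prv_orE _ _ (subst x z a) (Neg (subst x z a))); last first.
- apply: (@prv_absurd _ _ (Neg (subst x z a))); first by hyp.
  by apply: (@prv_allE _ _ x z (Neg (Neg a))) => //; hyp.
- by hyp.
by apply: (@prv_Reg _ _ (subst x y a)); hyp.
Qed.

(** The dual of the preceding argument, with theorems [Or _ w] in the role of
    inconsistent contexts. *)
Lemma prv_DD_ex s x a :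
  prv s (Dneg (Dneg (Ex x a))) -> prv s (Ex x (Dneg (Dneg a))).
Proof.
(* Proving the theorem [w] suffices, as its second disjunct contradicts the
   assumption. *)
pose w := Or (Ex x (Dneg (Dneg a))) (Dneg (Ex x a)).
have [y [_ yxa ya _]] := exists_eigen 0 x a [::].
have [z [_ zxa za zy]] := exists_eigen 0 x a (fv (subst x y a)).
have w_DD u : free_for u x a -> forall s, prv (Dneg (Dneg (subst x u a)) :: s) w.
  move=> uxa t; apply: prv_orI1; apply: (@prv_exI _ _ _ u (Dneg (Dneg a))) => //.
  by hyp.
have dec : prv [::] (Or (subst x y a) (Or (Neg (subst x y a)) w)).
  apply: (prv_orE (prv_DI _ (Ex x a))); last by do 3!apply: prv_orI2; hyp.
  apply: (@prv_exE _ _ x z a) => //.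
  - by move: za zy; rewrite /= !mem_cat !negb_or => -> ->.
  - by move=> g [<-|[]].
  - by hyp.
  apply: (prv_orE (prv_DI _ (Dneg (subst x z a)))); last first.
    by do 2!apply: prv_orI2; exact: w_DD.
  apply: (@prv_orE _ _ (subst x y a) (Neg (subst x y a))).
  - by apply: (@prv_Reg _ _ (subst x z a)); hyp.
  - by apply: prv_orI1; hyp.
  - by apply: prv_orI2; apply: prv_orI1; hyp.
have thm_w : prv [::] w.
  apply: (prv_orE (prv_DI _ (Ex x a))); last by apply: prv_orI2; hyp.
  apply: (@prv_exE _ _ x y a) => //.
  - by rewrite /= !mem_cat !negb_or; move: ya => /= ->.
  - by move=> g [<-|[]].
  - by hyp.
  apply: (prv_orE (prv_DI _ (Dneg (subst x y a)))); last exact: w_DD.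
  apply: (@prv_orE _ _ (Neg (subst x y a)) w); last by hyp.
    by apply: (prv_DE dec); hyp.
  by apply: (@prv_absurd _ _ (subst x y a)); hyp.
move=> sa; apply: (prv_orE (prv_thm _ thm_w)); first by hyp.
apply: (@prv_cS _ _ (Ex x a)); first by hyp.
by apply: prv_sub sa => g; right.
Qed.
End Quantifiers.

(** * Saturated theories *)

(** A prime theory that has witnesses, among the variables from [N] on, for the
    existential formulas that it contains and for the universal formulas that
    it lacks; the clauses that need a decision between formulas are only
    required inside the fragment [F]. *)
Record saturated L (N : nat) (F P : set (form L)) : Prop := Saturated {
  sat_le : forall a b, prv [:: a] b -> P a -> P b;
  sat_and : forall a b, P a -> P b -> P (And a b);
  sat_thm : forall a, prv [::] a -> P a;
  sat_bot : ~ P Bot;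
  sat_or : forall a b, F a -> F b -> P (Or a b) -> P a \/ P b;
  sat_ex : forall x a, F (Ex x a) -> P (Ex x a) ->
    exists2 y, N <= y & P (subst x y a);
  sat_all : forall x a, F (All x a) ->
    (forall y, N <= y -> P (subst x y a)) -> P (All x a) }.

Section Saturation.
Variables (L : language) (N : nat).
Implicit Types (a b c d : form L).

(** The pair [(c, d)] commits to [a] or to its rejection, with a witness where the
    quantifier calls for one. *)
Definition settles c d a : Prop :=
  prv [:: c] a /\ (forall x b, a = Ex x b ->
    exists2 y, N <= y & prv [:: c] (subst x y b))
  \/ prv [:: a] d /\ (forall x b, a = All x b ->
    exists2 y, N <= y & prv [:: subst x y b] d).

(** If [And c a] does not derive [d], then [a] joins the left formula, else the
    right one. An instance at a fresh variable may be added along: for an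
    existential formula on the left by existential elimination, for a universal
    one on the right by the constant domain principle. *)
Lemma settle c d a : ~ prv [:: c] d -> exists cd : form L * form L,
  [/\ prv [:: cd.1] c, prv [:: d] cd.2, ~ prv [:: cd.1] cd.2 &
      settles cd.1 cd.2 a].
Proof.
move=> ncd; have [cad|ncad] := pselect (prv [:: And c a] d); last first.
  have le_c : prv [:: And c a] c by apply: (@prv_andE1 _ _ _ a); hyp.
  have le_a : prv [:: And c a] a by apply: (@prv_andE2 _ _ c); hyp.
  have [[x [b ab]]|nex] := pselect (exists x b, a = Ex x b); last first.
    exists (And c a, d); split=> //; first exact: prv_refl.
    by left; split=> // x b ab; case: nex; exists x, b.
  have [y [Ny yxb yb]] := exists_eigen N x b (fv (And c a) ++ fv d).
  rewrite mem_cat negb_or => /andP[yca yd].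
  exists (And (And c a) (subst x y b), d); split=> /=.
  - by apply: prv_trans le_c; apply: prv_andE1; exact: prv_refl.
  - exact: prv_refl.
  - move=> cabd; apply: ncad; apply: (@prv_exE _ _ x y b) => //.
    + by move=> g [<-|[]].
    + by rewrite -ab.
    apply: (@prv_cut _ _ (And (And c a) (subst x y b))).
      by apply: prv_andI; hyp.
    by apply: prv_sub cabd => g [<-|[]]; left.
  left; split.
    by apply: prv_trans le_a; apply: prv_andE1; exact: prv_refl.
  move=> x' b' ab'; exists y => //; apply: (@prv_andE2 _ _ (And c a)).
  have [<- <-] : Ex x b = Ex x' b' by rewrite -ab.
  exact: prv_refl.
have le_d : prv [:: d] (Or d a) by apply: prv_orI1; hyp.
have le_a : prv [:: a] (Or d a) by apply: prv_orI2; hyp.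
have ncda : ~ prv [:: c] (Or d a).
  move=> cda; apply: ncd; apply: (prv_orE cda); first by hyp.
  apply: (@prv_cut _ _ (And c a)); first by apply: prv_andI; hyp.
  by apply: prv_sub cad => g [<-|[]]; left.
have [[x [b ab]]|nall] := pselect (exists x b, a = All x b); last first.
  exists (c, Or d a); split=> //; first exact: prv_refl.
  by right; split=> // x b ab; case: nall; exists x, b.
have [y [Ny yxb yb]] := exists_eigen N x b (fv c ++ fv (Or d a)).
rewrite mem_cat negb_or => /andP[yc yda].
exists (c, Or (subst x y b) (Or d a)); split=> /=.
- exact: prv_refl.
- by apply: (prv_trans le_d); apply: prv_orI2; exact: prv_refl.
- move=> /(prv_const_domain yxb yb yc yda) call; apply: ncda.
  apply: (prv_orE call); last by hyp.
  by apply: prv_orI2; rewrite ab; hyp.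
right; split.
  by apply: (prv_trans le_a); apply: prv_orI2; exact: prv_refl.
move=> x' b' ab'; exists y => //; apply: prv_orI1.
have [<- <-] : All x b = All x' b' by rewrite -ab.
exact: prv_refl.
Qed.

(** The theory consists of the consequences of the left formulas of an ascending
    sequence of underivable pairs, the [n]-th of which settles [e n]. *)
Lemma saturation (e : nat -> form L) (th : form L) : ~ prv [::] th ->
  exists2 P, saturated N (range e) P & ~ P th.
Proof.
move=> nth.
have /choice[f fP] : forall st : (form L * form L) * form L,
    exists cd : form L * form L, ~ prv [:: st.1.1] st.1.2 ->
    [/\ prv [:: cd.1] st.1.1, prv [:: st.1.2] cd.2, ~ prv [:: cd.1] cd.2 &
      settles cd.1 cd.2 st.2].
  move=> [[c d] a]; have [?|/settle] := pselect (prv [:: c] d).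
    by exists (c, d).
  by move=> /(_ a)[cd cdP]; exists cd.
pose st := fix st n := if n is m.+1 then f (st m, e m) else (Neg Bot, th).
have st_ok n : ~ prv [:: (st n).1] (st n).2.
  elim: n => [/= th1|n IHn]; last by have [] := fP (st n, e n) IHn.
  by apply: nth; apply: prv_cut th1; apply: prv_negI; hyp.
have stS n := fP (st n, e n) (st_ok n).
have st_le m n : m <= n ->
    prv [:: (st n).1] (st m).1 /\ prv [:: (st m).2] (st n).2.
  move=> /subnK <-; elim: (n - m) => [|k [IH1 IH2]].
    by split; exact: prv_refl.
  rewrite addSn; have [s1 s2 _ _] := stS (k + m).
  by split; [exact: prv_trans s1 IH1|exact: prv_trans IH2 s2].
pose P a := exists n, prv [:: (st n).1] a.
have P_le a b : prv [:: a] b -> P a -> P b.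
  by move=> ab [n na]; exists n; exact: prv_trans na ab.
have P_right a n : P a -> prv [:: a] (st n).2 -> False.
  move=> [m ma] an; apply: (st_ok (maxn m n)).
  have [l1 _] := st_le _ _ (leq_maxl m n); have [_ l2] := st_le _ _ (leq_maxr m n).
  by apply: prv_trans l1 _; apply: prv_trans ma _; apply: prv_trans an l2.
have P_and a b : P a -> P b -> P (And a b).
  move=> [m ma] [n nb]; exists (maxn m n); apply: prv_andI.
    by have [l1 _] := st_le _ _ (leq_maxl m n); exact: prv_trans l1 ma.
  by have [l1 _] := st_le _ _ (leq_maxr m n); exact: prv_trans l1 nb.
exists P; last by move=> Pth; apply: (P_right th 0) => //; exact: prv_refl.
split=> //.
- by move=> a a1; exists 0; exact: prv_thm.
- by move=> P0; apply: (P_right _ 0 P0); apply: prv_easq; exact: prv_refl.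
- move=> _ _ [m _ <-] [n _ <-] Pmn.
  have [_ _ _ [[mP _]|[mR _]]] := stS m; first by left; exists m.+1.
  have [_ _ _ [[nP _]|[nR _]]] := stS n; first by right; exists n.+1.
  case: (P_right _ (maxn m.+1 n.+1) Pmn).
  have [_ l1] := st_le _ _ (leq_maxl m.+1 n.+1).
  have [_ l2] := st_le _ _ (leq_maxr m.+1 n.+1).
  apply: (prv_orE (prv_refl _)).
    by apply: prv_sub (prv_trans mR l1) => g [<-|[]]; left.
  by apply: prv_sub (prv_trans nR l2) => g [<-|[]]; left.
- move=> x a [n _ nE] Pex; have [_ _ _ /= [[_ /(_ x a nE)[y Ny ya]]|[nR _]]] := stS n.
    by exists y => //; exists n.+1.
  by case: (P_right _ n.+1 Pex); rewrite -nE.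
- move=> x a [n _ nE] Pall; have [_ _ _ /= [[nP _]|[_ /(_ x a nE)[y Ny ya]]]] := stS n.
    by exists n.+1; rewrite -nE.
  by case: (P_right _ n.+1 (Pall y Ny)).
Qed.
End Saturation.

(** * The canonical structure of a saturated theory *)

Fixpoint over (L : language) (r : nat -> L) (phi : form L) : Prop :=
  match phi with
  | Atom R _ => exists i, r i = R
  | Bot => True
  | And a b | Or a b => over r a /\ over r b
  | Neg a | Dneg a | All _ a | Ex _ a => over r a
  end.

(** Keeping bound variables below [N] and free ones from [N] on makes every
    substitution between formulas of the fragment capture-free. *)
Definition fragment (L : language) (r : nat -> L) (N : nat) : set (form L) :=
  fun phi => [/\ over r phi, {in bv phi, forall x, x < N} &
                 {in fv phi, forall y, N <= y}].

Lemma over_subst (L : language) (r : nat -> L) x y (phi : form L) :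
  over r phi -> over r (subst x y phi).
Proof.
elim: phi => //= [a IHa b IHb|a IHa b IHb|z a IHa|z a IHa].
- by case=> /IHa ? /IHb.
- by case=> /IHa ? /IHb.
- by case: ifP => // _ /IHa.
- by case: ifP => // _ /IHa.
Qed.

Lemma bv_subst L x y (phi : form L) : bv (subst x y phi) = bv phi.
Proof.
elim: phi => //= [a -> b -> //|a -> b -> //|z a IHa|z a IHa].
- by case: ifP => // _; rewrite IHa.
- by case: ifP => // _; rewrite IHa.
Qed.

Lemma fv_subst L x y (phi : form L) z : z \in fv (subst x y phi) ->
  z = y \/ z \in fv phi /\ z != x.
Proof.
elim: phi => //= [R xs|a IHa b IHb|a IHa b IHb|w a IHa|w a IHa].
- by case/mapP => u uxs ->; case: eqP => [|/eqP]; [left|right].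
- by rewrite !mem_cat => /orP[/IHa|/IHb] [->|[-> ->]]; rewrite ?orbT; auto.
- by rewrite !mem_cat => /orP[/IHa|/IHb] [->|[-> ->]]; rewrite ?orbT; auto.
- rewrite !mem_filter => /andP[zw]; case: eqVneq => [<-|_ /IHa].
    by right; rewrite zw.
  by rewrite zw.
- rewrite !mem_filter => /andP[zw]; case: eqVneq => [<-|_ /IHa].
    by right; rewrite zw.
  by rewrite zw.
Qed.

Lemma fragment_subst (L : language) (r : nat -> L) N x y (a : form L) : N <= y ->
  fragment r N (All x a) -> fragment r N (subst x y a).
Proof.
move=> Ny [ra ba fa]; split; first exact: over_subst.
  by move=> z; rewrite bv_subst => zb; apply: ba; rewrite inE zb orbT.
by move=> z /fv_subst[->//|[za zx]]; apply: fa; rewrite /= mem_filter zx.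
Qed.

Fixpoint rank L (phi : form L) : nat :=
  match phi with
  | Atom _ _ | Bot => 0
  | And a b | Or a b => (rank a + rank b).+1
  | Neg a | Dneg a | All _ a | Ex _ a => (rank a).+1
  end.

Lemma rank_subst L x y (phi : form L) : rank (subst x y phi) = rank phi.
Proof.
elim: phi => //= [a -> b -> //|a -> b -> //|a -> //|a -> //|z a IHa|z a IHa].
- by case: ifP => // _; rewrite IHa.
- by case: ifP => // _; rewrite IHa.
Qed.

(** The element of the chain whose classical shadows, being 1 and being nonzero,
    are [A] and [B]. *)
Definition band (A B : Prop) : three :=
  if `[< A >] then v1 else if `[< B >] then vhalf else v0.

Lemma band_le (A B A' B' : Prop) : (A -> A') -> (B -> B') ->
  (band A B <= band A' B')%O.
Proof.
move=> AA BB; rewrite /band.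
by do ?case: asboolP => //=; tauto.
Qed.

Lemma band_all (A B : nat -> Prop) : (forall u, A u -> B u) ->
  min3 (range (fun u => band (A u) (B u))) = band (forall u, A u) (forall u, B u).
Proof.
move=> AB; apply: le_anti; apply/andP; split; last first.
  by apply: le_min3 => _ [u _ <-]; apply: band_le.
rewrite {2}/band; case: asboolP => [_|/existsNP[u nA]]; first exact: le_v1.
have le_u : (min3 (range (fun u => band (A u) (B u))) <= band (A u) (B u))%O.
  by apply: min3_le; exists u.
case: asboolP => [_|/existsNP[w nB]].
  by apply: le_trans le_u _; rewrite /band (asboolF nA); case: ifP.
apply: (@le_trans _ _ (band (A w) (B w))); first by apply: min3_le; exists w.
by rewrite /band (asboolF nB) asboolF // => /AB.
Qed.

Lemma band_ex (A B : nat -> Prop) :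
  max3 (range (fun u => band (A u) (B u))) = band (exists u, A u) (exists u, B u).
Proof.
apply: le_anti; apply/andP; split.
  by apply: max3_le => _ [u _ <-]; apply: band_le => ?; exists u.
rewrite {1}/band; case: asboolP => [[u Au]|_].
  by rewrite -(_ : band (A u) (B u) = v1) ?max3_ge ///band ?asboolT //; exists u.
case: asboolP => [[u Bu]|_]; last exact: ge_v0.
apply: (@le_trans _ _ (band (A u) (B u))); last by apply: max3_ge; exists u.
by rewrite /band (asboolT Bu); case: ifP.
Qed.

Section Canonical.
Variables (L : language) (r : nat -> L) (N : nat) (P : set (form L)).
Hypothesis satP : saturated N (fragment r N) P.
Local Notation F := (fragment r N).
Implicit Types (a b : form L).

Definition truth a : three := band (P (Dneg (Dneg a))) (P (Neg (Neg a))).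

Lemma sat_iff a b : prv [:: a] b -> prv [:: b] a -> P a <-> P b.
Proof. by move=> ab ba; split; apply: (sat_le satP). Qed.

Lemma sat_and_iff a b : P (And a b) <-> P a /\ P b.
Proof.
split=> [Pab|[Pa Pb]]; last exact: (sat_and satP).
by split; apply: (sat_le satP _ Pab);
  [apply: prv_andE1|apply: prv_andE2]; exact: prv_refl.
Qed.

Lemma sat_or_iff a b : F a -> F b -> P (Or a b) <-> P a \/ P b.
Proof.
move=> Fa Fb; split; first exact: (sat_or satP).
by case; apply: (sat_le satP); [apply: prv_orI1|apply: prv_orI2]; exact: prv_refl.
Qed.

Lemma le_DD a b : prv [:: a] b -> prv [:: Dneg (Dneg a)] (Dneg (Dneg b)).
Proof. by move/prv_DD_mono; apply; exact: prv_refl. Qed.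

Lemma le_NN a b : prv [:: a] b -> prv [:: Neg (Neg a)] (Neg (Neg b)).
Proof. by move/prv_NN_mono; apply; exact: prv_refl. Qed.

Lemma sat_compl a b : F a -> F b -> prv [::] (Or a b) -> prv [:: And a b] Bot ->
  P a <-> ~ P b.
Proof.
move=> Fa Fb ab nab; split=> [Pa Pb|nPb].
  by apply: (sat_bot satP); apply: (sat_le satP nab); exact: (sat_and satP).
by case: (sat_or satP Fa Fb (sat_thm satP ab)).
Qed.

Lemma sat_NN_DD a : P (Dneg (Dneg a)) -> P (Neg (Neg a)).
Proof.
by apply: (sat_le satP); apply: prv_NNI; apply: prv_DDE; exact: prv_refl.
Qed.

Lemma truth_and a b : truth (And a b) = Order.min (truth a) (truth b).
Proof.
have -> : truth (And a b) =
    band (P (Dneg (Dneg a)) /\ P (Dneg (Dneg b)))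
         (P (Neg (Neg a)) /\ P (Neg (Neg b))).
  rewrite /truth; congr band;
    apply/propext; rewrite -sat_and_iff; apply: sat_iff.
  - by apply: prv_andI; apply: le_DD;
      [apply: prv_andE1|apply: prv_andE2]; exact: prv_refl.
  - by apply: prv_DD_and; [apply: prv_andE1|apply: prv_andE2]; exact: prv_refl.
  - by apply: prv_andI; apply: le_NN;
      [apply: prv_andE1|apply: prv_andE2]; exact: prv_refl.
  - by apply: prv_NN_and; [apply: prv_andE1|apply: prv_andE2]; exact: prv_refl.
rewrite /truth /band !asbool_and; have := @sat_NN_DD a; have := @sat_NN_DD b.
by do ?case: asboolP => //=; tauto.
Qed.

Lemma truth_or a b : F a -> F b -> truth (Or a b) = Order.max (truth a) (truth b).
Proof.
move=> Fa Fb; have -> : truth (Or a b) =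
    band (P (Dneg (Dneg a)) \/ P (Dneg (Dneg b)))
         (P (Neg (Neg a)) \/ P (Neg (Neg b))).
  rewrite /truth; congr band;
    apply/propext; rewrite -sat_or_iff //; apply: sat_iff.
  - by apply: prv_DD_or; exact: prv_refl.
  - apply: (prv_orE (prv_refl _)).
      by apply: (@prv_DD_mono _ _ a); [apply: prv_orI1|]; hyp.
    by apply: (@prv_DD_mono _ _ b); [apply: prv_orI2|]; hyp.
  - by apply: prv_NN_or; exact: prv_refl.
  - apply: (prv_orE (prv_refl _)).
      by apply: (@prv_NN_mono _ _ a); [apply: prv_orI1|]; hyp.
    by apply: (@prv_NN_mono _ _ b); [apply: prv_orI2|]; hyp.
rewrite /truth /band !asbool_or; have := @sat_NN_DD a; have := @sat_NN_DD b.
by do ?case: asboolP => //=; tauto.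
Qed.

Lemma truth_neg a : F a -> truth (Neg a) = neg3 (truth a).
Proof.
move=> Fa; have DDN : P (Dneg (Dneg (Neg a))) <-> P (Neg a).
  apply: sat_iff; [apply: prv_DDE|apply: prv_DDN]; exact: prv_refl.
have NNN : P (Neg (Neg (Neg a))) <-> P (Neg a).
  apply: sat_iff; [apply: prv_NNN|apply: prv_NNI]; exact: prv_refl.
have compl : P (Neg a) <-> ~ P (Neg (Neg a)).
  apply: sat_compl => //; first exact: prv_S.
  apply: (@prv_absurd _ _ (Neg a)); [apply: prv_andE1|apply: prv_andE2]; exact: prv_refl.
rewrite /truth /band (asbool_equiv_eq DDN) (asbool_equiv_eq NNN)
  (asbool_equiv_eq compl) asbool_neg.
by have := @sat_NN_DD a; do ?case: asboolP => //=; tauto.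
Qed.

Lemma truth_D a : F a -> truth (Dneg a) = D3 (truth a).
Proof.
move=> Fa; have DDD : P (Dneg (Dneg (Dneg a))) <-> P (Dneg a).
  apply: sat_iff; [apply: prv_DDE|apply: prv_DDD]; exact: prv_refl.
have NND : P (Neg (Neg (Dneg a))) <-> P (Dneg a).
  apply: sat_iff; [apply: prv_NND|apply: prv_NNI]; exact: prv_refl.
have compl : P (Dneg a) <-> ~ P (Dneg (Dneg a)).
  apply: sat_compl => //; first exact: prv_DI.
  apply: (@prv_cS _ _ a); [apply: prv_andE1|apply: prv_andE2]; exact: prv_refl.
rewrite /truth /band (asbool_equiv_eq DDD) (asbool_equiv_eq NND)
  (asbool_equiv_eq compl) asbool_neg.
by do ?case: asboolP.
Qed.

Lemma fragment_free x a u : F (All x a) -> free_for (N + u) x a.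
Proof.
move=> [_ ba _]; apply: free_for_bv; apply/negP => ua.
have /ba : N + u \in bv (All x a) by rewrite inE ua orbT.
by rewrite ltnNge leq_addr.
Qed.

Lemma truth_all x a : F (All x a) ->
  truth (All x a) = min3 (range (fun u => truth (subst x (N + u) a))).
Proof.
move=> Fa; rewrite band_all; last by move=> u; exact: sat_NN_DD.
rewrite /truth; congr band;
  apply/propext; split=> [Pall u|Pu].
- apply: (sat_le satP _ Pall); apply: le_DD; apply: prv_allE; last by hyp.
  exact: fragment_free.
- apply: (sat_le satP (a := All x (Dneg (Dneg a)))).
    by apply: prv_all_DD; exact: prv_refl.
  by apply: (sat_all satP) => // y Ny; rewrite -(subnKC Ny); exact: Pu.
- apply: (sat_le satP _ Pall); apply: le_NN; apply: prv_allE; last by hyp.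
  exact: fragment_free.
- apply: (sat_le satP (a := All x (Neg (Neg a)))).
    by apply: prv_all_NN; exact: prv_refl.
  by apply: (sat_all satP) => // y Ny; rewrite -(subnKC Ny); exact: Pu.
Qed.

Lemma truth_ex x a : F (Ex x a) ->
  truth (Ex x a) = max3 (range (fun u => truth (subst x (N + u) a))).
Proof.
move=> Fa; rewrite band_ex /truth; congr band;
  apply/propext; split=> [Pex|[u Pu]].
- have : P (Ex x (Dneg (Dneg a))).
    by apply: (sat_le satP _ Pex); apply: prv_DD_ex; exact: prv_refl.
  by case/(sat_ex satP) => // y Ny; exists (y - N); rewrite subnKC.
- apply: (sat_le satP _ Pu); apply: le_DD; apply: prv_exI; last by hyp.
  exact: fragment_free.
- have : P (Ex x (Neg (Neg a))).
    by apply: (sat_le satP _ Pex); apply: prv_NN_ex; exact: prv_refl.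
  by case/(sat_ex satP) => // y Ny; exists (y - N); rewrite subnKC.
- apply: (sat_le satP _ Pu); apply: le_NN; apply: prv_exI; last by hyp.
  exact: fragment_free.
Qed.

(** The carrier consists of the variables from [N] on; the number [u] stands for
    the variable [N + u]. *)
Definition canonical : structure L nat :=
  fun R u => truth (Atom R (map_tuple (addn N) u)).

Lemma truth_bot : truth Bot = v0.
Proof.
have nB a : prv [:: a] Bot -> `[< P a >] = false.
  by move=> a0; apply: asboolF => /(sat_le satP a0); exact: sat_bot satP.
rewrite /truth /band !nB //; last by apply: prv_DDE; exact: prv_refl.
by apply: (@prv_absurd _ _ (Neg Bot)); [apply: prv_negI|]; hyp.
Qed.

(** The induction is on the rank, as the instances of a quantified formula are
    not among its subformulas. *)
Lemma val3_canonical a : F a -> val3 canonical a (subn^~ N) = truth a.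
Proof.
have [n] := ubnP (rank a); elim: n a => // n IHn.
have inst a x : rank a < n -> (forall u, F (subst x (N + u) a)) ->
    (forall u, free_for (N + u) x a) ->
    range (fun u => val3 canonical a (setv (subn^~ N) x u)) =
    range (fun u => truth (subst x (N + u) a)).
  move=> an Fa fr; apply: eq_imagel => u _.
  by rewrite -IHn ?rank_subst // val3_subst // addKn.
case=> /= [R xs||a b|a b|a|a|x a|x a] an Fa.
- congr truth; congr Atom; apply: val_inj => /=.
  rewrite -map_comp -[RHS]map_id; apply/eq_in_map => y ys /=.
  by rewrite subnKC //; case: Fa => _ _; apply.
- by rewrite truth_bot.
- case: Fa => [[ra rb] ba fa].
  have Fa : F a by split=> // z zin; [apply: ba|apply: fa]; rewrite mem_cat zin.
  have Fb : F b by split=> // z zin; [apply: ba|apply: fa]; rewrite mem_cat zin orbT.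
  have {}an : rank a + rank b < n := an.
  by rewrite truth_and !IHn // (leq_ltn_trans _ an) ?leq_addl ?leq_addr.
- case: Fa => [[ra rb] ba fa].
  have Fa : F a by split=> // z zin; [apply: ba|apply: fa]; rewrite mem_cat zin.
  have Fb : F b by split=> // z zin; [apply: ba|apply: fa]; rewrite mem_cat zin orbT.
  have {}an : rank a + rank b < n := an.
  by rewrite truth_or // !IHn // (leq_ltn_trans _ an) ?leq_addl ?leq_addr.
- by rewrite truth_neg // IHn.
- by rewrite truth_D // IHn.
- rewrite truth_all // inst // => u; last exact: fragment_free.
  by apply: fragment_subst Fa; exact: leq_addr.
- rewrite truth_ex // inst // => u; last exact: fragment_free.
  by apply: fragment_subst Fa; exact: leq_addr.
Qed.
End Canonical.

(** * Completeness *)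

(** The formulas over countably many predicate letters are enumerated by decoding
    the elements of a countable type of trees. *)
Section Enumeration.
Variables (L : language) (r : nat -> L).

Fixpoint decode (t : GenTree.tree nat) : form L :=
  match t with
  | GenTree.Leaf _ => Bot
  | GenTree.Node 0 [:: a; b] => And (decode a) (decode b)
  | GenTree.Node 1 [:: a; b] => Or (decode a) (decode b)
  | GenTree.Node 2 [:: a] => Neg (decode a)
  | GenTree.Node 3 [:: a] => Dneg (decode a)
  | GenTree.Node 4 [:: GenTree.Leaf x; a] => All x (decode a)
  | GenTree.Node 5 [:: GenTree.Leaf x; a] => Ex x (decode a)
  | GenTree.Node 6 (GenTree.Leaf i :: ts) => Atom (r i)
      [tuple (if nth (GenTree.Leaf 0) ts j is GenTree.Leaf x then x else 0)
         | j < arity (r i)]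
  | _ => Bot
  end.

Lemma decode_surj (phi : form L) : over r phi -> exists t, decode t = phi.
Proof.
elim: phi => [R xs||a IHa b IHb|a IHa b IHb|a IHa|a IHa|x a IHa|x a IHa] /=.
- case=> i ri; case: _ / ri xs => xs.
  exists (GenTree.Node 6 (GenTree.Leaf i :: [seq GenTree.Leaf x | x <- xs])).
  congr Atom; apply: eq_from_tnth => j; rewrite tnth_mktuple.
  by rewrite (nth_map 0) ?size_tuple // (tnth_nth 0).
- by move=> _; exists (GenTree.Leaf 0).
- by case=> /IHa[s <-] /IHb[t <-]; exists (GenTree.Node 0 [:: s; t]).
- by case=> /IHa[s <-] /IHb[t <-]; exists (GenTree.Node 1 [:: s; t]).
- by case/IHa=> [t <-]; exists (GenTree.Node 2 [:: t]).
- by case/IHa=> [t <-]; exists (GenTree.Node 3 [:: t]).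
- by case/IHa=> [t <-]; exists (GenTree.Node 4 [:: GenTree.Leaf x; t]).
- by case/IHa=> [t <-]; exists (GenTree.Node 5 [:: GenTree.Leaf x; t]).
Qed.

Definition enum_form (n : nat) : form L :=
  if unpickle n is Some t then decode t else Bot.

Lemma enum_form_surj (phi : form L) : over r phi -> exists n, enum_form n = phi.
Proof.
by case/decode_surj=> t <-; exists (pickle t); rewrite /enum_form pickleK.
Qed.
End Enumeration.

Lemma over_sub (L : language) (r r' : nat -> L) (phi : form L) :
  (forall i, exists j, r' j = r i) -> over r phi -> over r' phi.
Proof.
move=> rr'; elim: phi => //= [R xs [i <-]|a IHa b IHb|a IHa b IHb]; first exact: rr'.
- by case=> /IHa ? /IHb.
- by case=> /IHa ? /IHb.
Qed.

(** A formula has finitely many letters, so a sequence exhausts them; merging two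
    sequences handles the binary connectives. *)
Lemma exists_over (L : language) (phi : form L) : exists r : nat -> L, over r phi.
Proof.
have merge (a b : form L) :
    (exists r : nat -> L, over r a) -> (exists r : nat -> L, over r b) ->
    exists r : nat -> L, over r a /\ over r b.
  move=> [r ra] [r' rb]; exists (fun n => if odd n then r n./2 else r' n./2).
  split; [apply: over_sub ra|apply: over_sub rb] => i.
    by exists i.*2.+1; rewrite /= odd_double uphalf_double.
  by exists i.*2; rewrite odd_double doubleK.
elim: phi => //= [R xs||a IHa b IHb|a IHa b IHb].
- by exists (fun=> R), 0.
- by case: (rel_letter_inhabited L) => R; exists (fun=> R).
- exact: merge.
- exact: merge.
Qed.

Definition close L (l : seq nat) (phi : form L) : form L := foldr (@All L) phi l.

Lemma fv_close L l (phi : form L) : fv (close l phi) = [seq y <- fv phi | y \notin l].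
Proof.
elim: l => /= [|x l ->]; first by rewrite filter_predT.
by rewrite -filter_predI; apply: eq_filter => y; rewrite /= inE negb_or.
Qed.

Lemma prv_close L l (phi : form L) : prv [::] (close l phi) -> prv [::] phi.
Proof.
elim: l => //= x l IHl all_x; apply: IHl.
by rewrite -[close l phi](subst_id x); apply: prv_allE => //; exact: free_for_id.
Qed.

Lemma val3_close L T (I : structure L T) l (phi : form L) f :
  (val3 I (close l phi) f < v1)%O -> exists g, (val3 I phi g < v1)%O.
Proof.
elim: l f => [|x l IHl] f /=; first by exists f.
have [|u _ <-] := @min3_in (range (fun u => val3 I (close l phi) (setv f x u))).
  by exists (val3 I (close l phi) (setv f x (f x))), (f x).
exact: IHl.
Qed.

Lemma weak_completeness L (th : form L) : ~ prv [::] th ->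
  exists (I : structure L nat) f, (val3 I th f < v1)%O.
Proof.
move=> nth; pose cl := close (fv th) th.
have ncl : ~ prv [::] cl by move=> /prv_close.
have [r rcl] := exists_over cl.
pose N := (\max_(x <- bv cl) x).+1.
have Fcl : fragment r N cl.
  split=> //; first by move=> x xcl; rewrite ltnS; exact: leq_bigmax_seq.
  by move=> y; rewrite fv_close mem_filter; case/andP=> /negP.
have [P satP Pcl] := saturation N (enum_form r) ncl.
have {}satP : saturated N (fragment r N) P.
  have enumF a : fragment r N a -> range (enum_form r) a.
    by case=> /enum_form_surj[n <-] _ _; exists n.
  case: satP => le an tm bt orP exP allP; split=> //.
  - by move=> a b /enumF Fa /enumF Fb; exact: orP.
  - by move=> x a /enumF; exact: exP.
  - by move=> x a /enumF; exact: allP.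
exists (canonical N P); apply: (@val3_close _ _ _ (fv th) _ (subn^~ N)).
rewrite (val3_canonical satP) // /truth /band asboolF; first by case: ifP.
move=> DDcl; apply: Pcl; apply: (sat_le satP _ DDcl).
by apply: prv_DDE; hyp.
Qed.

Lemma finite_completeness L (s : seq (form L)) (a : form L) : ~ prv s a ->
  exists (I : structure L nat) f, refutes I f (listset s) a.
Proof.
move=> nsa; have [|I [f /val3_imp If]] := @weak_completeness L (imp (conj s) a).
  by move=> /prv_imp /prv_conj.
exists I, f; split; first exact: lt_le_trans If (le_v1 _).
by move=> g gs; apply: lt_le_trans If (val3_conj I f gs).
Qed.

Lemma completeness L (G : set (form L)) (a : form L) :
  entails G a -> derivable G a.
Proof.
move=> Ga; apply: contrapT => nGa.
have [s sG|T [I [f [a1 Ia]]]] := @compactness L nat G a.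
  by apply: finite_completeness => -[G0 G0a G0s]; apply: nGa; exists G0 => // g /G0s /sG.
have := entails_val3 I f Ga; rewrite leNgt lt_min3 //.
by move=> _ [g Gg <-]; exact: Ia.
Qed.

Theorem corollary1 (L : language) (Gamma : set (form L)) (alpha : form L) :
  derivable Gamma alpha <-> entails Gamma alpha.
Proof. by split; [exact: soundness|exact: completeness]. Qed.
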